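(* Let $(X,d)$ be a minimally nice length space. Then $X$ is uniform if and only if $X$ is John and GHS.
   Context: A metric space $(X,d)$ is minimally nice if it is locally compact, incomplete and rectifiably connected (every pair of points can be joined by a curve of finite length) and the identity map $(X,d)\to(X,l)$ is continuous, where $l(x,y)$ is the infimum of the $d$-lengths $\ell(\gamma)$ of rectifiable curves $\gamma$ in $X$ joining $x$ and $y$; it is a length space if $d=l$. The metric boundary is $\partial X=\bar X\setminus X$, where $\bar X$ is the metric completion, and $d(z)=\mathrm{dist}(z,\partial X)$ for $z\in X$. The quasihyperbolic metric is $k(x,y)=\inf_\gamma\int_\gamma \frac{ds}{d(z)}$, the infimum over all rectifiable curves $\gamma$ in $X$ with endpoints $x,y$, with $ds$ the arc-length element with respect to $d$; a quasihyperbolic geodesic is a geodesic of $(X,k)$. Write $B(x,r)=\{z\in X: d(z,x)<r\}$. For $a\ge1$, an arc $\alpha$ with endpoints $x,y$ is a double $a$-cone arc if $\min\{\ell(\alpha[x,z]),\ell(\alpha[z,y])\}\le a\,d(z)$ for all $z\in\alpha$, where $\alpha[x,z]$ and $\alpha[z,y]$ are the subarcs of $\alpha$ between the indicated points and $\ell$ is $d$-length; it is $a$-quasiconvex if $\ell(\alpha)\le a\,d(x,y)$. $X$ is John if for some $a\ge1$ every pair of points in $X$ can be joined by a double $a$-cone arc in $X$; $X$ is uniform if for some $a\ge1$ every pair of points in $X$ can be joined by an arc in $X$ that is both double $a$-cone and $a$-quasiconvex. $X$ satisfies the Gehring-Hayman condition if there is $C_{gh}\ge1$ such that for all $x,y\in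 X$, each quasihyperbolic geodesic $\gamma$ joining $x$ and $y$ and every curve $\beta$ in $X$ joining $x$ and $y$, $\ell(\gamma)\le C_{gh}\,\ell(\beta)$. $X$ satisfies the ball separation condition if there is $C_{bs}\ge1$ such that for all $x,y\in X$, each quasihyperbolic geodesic $\gamma$ joining $x$ and $y$, every $z\in\gamma$ and every curve $\beta$ in $X$ joining $x$ and $y$, $B(z,C_{bs}d(z))\cap\beta\ne\emptyset$. $X$ is a GHS space if it is a minimally nice length space satisfying both the Gehring-Hayman condition and the ball separation condition. *)

(* Defs.v *)
From HB Require Import structures.
From mathcomp Require Import all_boot all_order all_algebra.
From mathcomp Require Import generic_quotient lra.
From mathcomp Require Import all_classical all_reals all_analysis.

Set Implicit Arguments.
Unset Strict Implicit.
Unset Printing Implicit Defensive.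

Import Order.TTheory GRing.Theory Num.Theory.
Import numFieldNormedType.Exports.
Import metricType_numDomainType.

Local Open Scope classical_set_scope.
Local Open Scope quotient_scope.
Local Open Scope ring_scope.

(* [completeType] requires a pointed carrier, which an arbitrary metric space
   does not come with; for metric spaces sequential completeness is the usual
   definition. *)
Definition metric_complete (R : realType) (X : metricType R) :=
  forall u : nat -> X, cauchy (u @ \oo) -> exists l : X, u @ \oo --> l.

Section cauchy_sequences.
Context {R : realType} {X : metricType R}.
Implicit Types u v w : nat -> X.

Definition cauchy_sequence u : bool := `[< cauchy (u @ \oo) >].

Definition seq_mdist u v : R := limn (fun n => mdist (u n) (v n)).

Lemma cauchy_mdistP u : cauchy (u @ \oo) <->
  forall e : R, 0 < e ->
    exists N, forall m n, (N <= m)%N -> (N <= n)%N -> mdist (u m) (u n) < e.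
Proof.
split=> [/cauchyP cu e e0|h].
  have [x [N _ Nx]] := cu _ (divr_gt0 e0 (ltr0n _ 2)).
  exists N => m n Nm Nn; rewrite (le_lt_trans (metric_triangle _ x _))//.
  rewrite (splitr e) ltrD//.
    by have := Nx m Nm; rewrite /= ballEmdist/= metric_sym.
  by have := Nx n Nn; rewrite /= ballEmdist.
apply: cauchy_exP => e /h[N NP]; exists (u N); exists N => // n /= Nn.
by rewrite ballEmdist /=; exact: NP.
Qed.

Lemma ler_dist_mdist (x y x' y' : X) :
  `|mdist x y - mdist x' y'| <= mdist x x' + mdist y y'.
Proof.
have H (a b a' b' : X) : mdist a b - mdist a' b' <= mdist a a' + mdist b b'.
  rewrite lerBlDr (le_trans (metric_triangle _ a' _))//.
  rewrite -addrA lerD2l (le_trans (metric_triangle _ b' _))//.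
  by rewrite addrC (metric_sym b' b).
rewrite ler_norml H andbT lerNl opprB (metric_sym x x') (metric_sym y y').
exact: H.
Qed.

Lemma seq_mdist_cvg u v : cauchy (u @ \oo) -> cauchy (v @ \oo) ->
  mdist (u n) (v n) @[n --> \oo] --> seq_mdist u v.
Proof.
move=> /cauchy_mdistP cu /cauchy_mdistP cv.
apply/cauchy_cvgP; apply: cauchy_exP => e e0.
have e20 : 0 < e / 2 by rewrite divr_gt0.
have [N HN] := cu _ e20; have [M HM] := cv _ e20.
exists (mdist (u (maxn N M)) (v (maxn N M))).
exists (maxn N M) => // n /= NMn; rewrite /ball/=.
rewrite (le_lt_trans (ler_dist_mdist _ _ _ _))// (splitr e) ltrD//.
  by apply: HN; rewrite ?leq_maxl// (leq_trans (leq_maxl _ _) NMn).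
by apply: HM; rewrite ?leq_maxr// (leq_trans (leq_maxr _ _) NMn).
Qed.

Lemma seq_mdistxx u : seq_mdist u u = 0.
Proof.
rewrite /seq_mdist (_ : (fun n => _) = cst 0) ?lim_cst//.
by apply/funext => n; exact: mdistxx.
Qed.

Lemma seq_mdist_sym u v : seq_mdist u v = seq_mdist v u.
Proof.
by rewrite /seq_mdist; congr (limn _); apply/funext => n; exact: metric_sym.
Qed.

Lemma seq_mdist_triangle u v w :
  cauchy (u @ \oo) -> cauchy (v @ \oo) -> cauchy (w @ \oo) ->
  seq_mdist u w <= seq_mdist u v + seq_mdist v w.
Proof.
move=> cu cv cw.
have h : mdist (u n) (v n) + mdist (v n) (w n) @[n --> \oo] -->
    seq_mdist u v + seq_mdist v w.
  exact: cvgD (seq_mdist_cvg cu cv) (seq_mdist_cvg cv cw).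
apply: (ler_cvg_to (seq_mdist_cvg cu cw) h).
by apply: nearW => n; exact: metric_triangle.
Qed.

Lemma seq_mdist_ge0 u v : cauchy (u @ \oo) -> cauchy (v @ \oo) ->
  0 <= seq_mdist u v.
Proof.
move=> cu cv; apply: limr_ge; first by apply/cvg_ex; eexists; exact: seq_mdist_cvg.
by apply: nearW => n; exact: mdist_ge0.
Qed.

End cauchy_sequences.

Definition cauchy_seq_of (R : realType) (X : metricType R) :=
  {u : nat -> X | cauchy_sequence u}.

Section completion.
Context {R : realType} (X : metricType R).

HB.instance Definition _ := Choice.on (cauchy_seq_of X).

Lemma cauchy_seq_ofP (u : cauchy_seq_of X) : cauchy (val u @ \oo).
Proof. by have /asboolP := valP u. Qed.

Definition cauchy_equiv (u v : cauchy_seq_of X) : bool :=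
  seq_mdist (val u) (val v) == 0.

Lemma cauchy_equiv_refl : reflexive cauchy_equiv.
Proof. by move=> u; rewrite /cauchy_equiv seq_mdistxx. Qed.

Lemma cauchy_equiv_sym : symmetric cauchy_equiv.
Proof. by move=> u v; rewrite /cauchy_equiv seq_mdist_sym. Qed.

Lemma cauchy_equiv_trans : transitive cauchy_equiv.
Proof.
move=> v u w /eqP uv /eqP vw; apply/eqP/le_anti.
rewrite seq_mdist_ge0 ?andbT; [|exact: cauchy_seq_ofP..].
rewrite (le_trans (seq_mdist_triangle _ (cauchy_seq_ofP v) _))//;
  [exact: cauchy_seq_ofP..|].
by rewrite uv vw addr0.
Qed.

Canonical cauchy_equiv_rel := EquivRel cauchy_equiv
  cauchy_equiv_refl cauchy_equiv_sym cauchy_equiv_trans.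

Definition completion := {eq_quot cauchy_equiv_rel}.

HB.instance Definition _ := Choice.on completion.
HB.instance Definition _ := EqQuotient.on completion.

Definition completion_mdist (p q : completion) : R :=
  seq_mdist (val (repr p)) (val (repr q)).

Lemma completion_mdistxx p : completion_mdist p p = 0.
Proof. exact: seq_mdistxx. Qed.

Lemma completion_mdist_positivity p q : completion_mdist p q = 0 -> p = q.
Proof.
move=> pq; rewrite -[p]reprK -[q]reprK; apply/eqquotP.
exact/eqP.
Qed.

Lemma completion_mdist_sym p q : completion_mdist p q = completion_mdist q p.
Proof. exact: seq_mdist_sym. Qed.

Lemma completion_mdist_triangle q p r :
  completion_mdist p r <= completion_mdist p q + completion_mdist q r.
Proof. by apply: seq_mdist_triangle; exact: cauchy_seq_ofP. Qed.

HB.instance Definition _ := @isMetric.Build R completion completion_mdist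
  completion_mdistxx completion_mdist_positivity completion_mdist_sym
  completion_mdist_triangle.

Lemma cst_cauchy (x : X) : cauchy_sequence (fun _ : nat => x).
Proof.
apply/asboolP/cauchy_mdistP => e e0; exists 0%N => m n _ _.
by rewrite mdistxx.
Qed.

Definition embed (x : X) : completion :=
  \pi_completion (exist _ (fun _ => x) (cst_cauchy x) : cauchy_seq_of X).

Definition metric_boundary : set completion := ~` range embed.

Lemma mdist_pi (u v : cauchy_seq_of X) :
  mdist (\pi_completion u) (\pi_completion v) =
  seq_mdist (val u) (val v).
Proof.
have H (w : cauchy_seq_of X) :
    seq_mdist (val (repr (\pi_completion w))) (val w) = 0.
  have /eqquotP : \pi_completion (repr (\pi_completion w)) = \pi_completion w.
    by rewrite reprK.
  by rewrite /= /cauchy_equiv => /eqP.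
have cP := cauchy_seq_ofP.
apply/le_anti/andP; split; rewrite [mdist _ _]/(completion_mdist _ _).
- rewrite /completion_mdist.
  rewrite (le_trans (seq_mdist_triangle _ (cP u) _))//.
  rewrite H add0r (le_trans (seq_mdist_triangle _ (cP v) _))//.
  by rewrite (seq_mdist_sym (val v)) H addr0.
- rewrite /completion_mdist.
  rewrite (le_trans (seq_mdist_triangle _ (cP (repr (\pi_completion u))) _))//.
  rewrite (seq_mdist_sym (val u)) H add0r.
  rewrite (le_trans (seq_mdist_triangle _ (cP (repr (\pi_completion v))) _))//.
  by rewrite H addr0.
Qed.

Lemma embed_isometry (x y : X) : mdist (embed x) (embed y) = mdist x y.
Proof. by rewrite mdist_pi /seq_mdist/= lim_cst. Qed.

Lemma cauchy_cvg_completion (u : cauchy_seq_of X) :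
  embed (val u n) @[n --> \oo] --> (\pi_completion u).
Proof.
apply/cvgrPdist_le => e e0.
have /cauchy_mdistP/(_ _ e0)[N HN] := cauchy_seq_ofP u.
exists N => // n /= Nn; rewrite mdist_pi.
apply: limr_le.
  by apply/cvg_ex; eexists; apply: seq_mdist_cvg;
    [exact: cauchy_seq_ofP|exact/asboolP/cst_cauchy].
by exists N => // m /= Nm; rewrite ltW// HN.
Qed.

Lemma embed_dense : dense (range embed).
Proof.
move=> O [p Op] oO; pose u := repr p.
have up : embed (val u n) @[n --> \oo] --> p.
  by rewrite -[p]reprK; exact: cauchy_cvg_completion.
have /up[N _ NO] : nbhs p O by exact: open_nbhs_nbhs.
by exists (embed (val u N)); split; [exact: NO (leqnn N)|exists (val u N)].
Qed.

Lemma completion_complete : metric_complete completion.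
Proof.
move=> p /cauchy_mdistP cp.
have xP n : exists x : X, mdist (p n) (embed x) < n.+1%:R^-1.
  have n0 : 0 < n.+1%:R^-1 :> R by rewrite invr_gt0.
  have /cvgrPdist_lt/(_ _ n0)[N _ /(_ N (leqnn N))/= h] :=
    @cauchy_cvg_completion (repr (p n)).
  by exists (val (repr (p n)) N); move: h; rewrite reprK.
have [x xE] := choice xP.
have n0 (e : R) : 0 < e -> exists N, forall n, (N <= n)%N -> n.+1%:R^-1 < e.
  by move=> e0; have [N _ NP] := near_infty_natSinv_lt (PosNum e0); exists N.
have cx : cauchy_sequence x.
  apply/asboolP/cauchy_mdistP => e e0.
  have e30 : 0 < e / 3 by rewrite divr_gt0.
  have [N NP] := cp _ e30; have [M MP] := n0 _ e30.
  exists (maxn N M) => m n; rewrite !geq_max => /andP[Nm Mm] /andP[Nn Mn].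
  rewrite -embed_isometry (le_lt_trans (metric_triangle _ (p m) _))//.
  rewrite (@lt_le_trans _ _ (e / 3 + (e / 3 + e / 3)))//; last first.
    by lra.
  rewrite ltrD//.
    by rewrite metric_sym (lt_trans (xE m))// MP.
  rewrite (le_lt_trans (metric_triangle _ (p n) _))// ltrD//; first exact: NP.
  by rewrite (lt_trans (xE n))// MP.
pose u : cauchy_seq_of X := exist _ x cx.
exists (\pi_completion u); apply/cvgrPdist_lt => e e0.
have e20 : 0 < e / 2 by rewrite divr_gt0.
have /cvgrPdist_lt/(_ _ e20)[N _ NP] := @cauchy_cvg_completion u.
have [M MP] := n0 _ e20.
exists (maxn N M) => // n /=; rewrite geq_max => /andP[Nn Mn].
rewrite (le_lt_trans (metric_triangle _ (embed (x n)) _))// (splitr e) ltrD//.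
  exact: NP.
by rewrite metric_sym (lt_trans (xE n))// MP.
Qed.

Definition boundary_dist (z : X) : R :=
  inf [set mdist (embed z) p | p in metric_boundary].

End completion.

Arguments embed {R X}.
Arguments boundary_dist {R X}.

Section curves.
Context {R : realType} {X : metricType R}.

(* Degenerate parameter intervals are allowed: they give the constant curve
   (and arc) joining a point to itself. Values off [lo, hi] are irrelevant. *)
Record curve := Curve {
  lo : R;
  hi : R;
  path_of :> R -> X;
  lo_le_hi : lo <= hi;
  path_of_continuous : {within `[lo, hi], continuous path_of}
}.

Implicit Types g : curve.

Definition joins g (x y : X) := g (lo g) = x /\ g (hi g) = y.

Definition trace g : set X := g @` `[lo g, hi g].

Definition is_arc g := {in `[lo g, hi g] &, injective g}.

(* The analogue of [variation] and [total_variation] for maps into a metric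
   space; length f a b is the length of f restricted to [a, b]. *)
Definition metric_variation (a b : R) (f : R -> X) (s : seq R) : R :=
  let F := f \o nth b (a :: s) in
  \sum_(0 <= n < size s) mdist (F n) (F n.+1).

Definition length (f : R -> X) (a b : R) : \bar R :=
  ereal_sup [set (metric_variation a b f s)%:E | s in itv_partition a b].

Definition curve_length g : \bar R := length g (lo g) (hi g).

Definition rectifiable g := (curve_length g < +oo)%E.

Definition intrinsic_dist (x y : X) : \bar R :=
  ereal_inf [set curve_length g | g in [set g | rectifiable g /\ joins g x y]].

(* For rectifiable g and 0 <= s <= curve_length g, this is the point g t for
   the least t such that g restricted to [lo g, t] has length s. *)
Definition arclength_param g (s : R) : X :=
  g (inf [set t | t \in `[lo g, hi g] /\ (s%:E <= length g (lo g) t)%E]).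

Definition line_integral (rho : X -> R) g : \bar R :=
  (\int[@lebesgue_measure R]_(s in `[0%R, fine (curve_length g)])
     (rho (arclength_param g s))%:E)%E.

Definition quasihyperbolic_dist (x y : X) : \bar R :=
  ereal_inf [set line_integral (fun z => (boundary_dist z)^-1) g
            | g in [set g | rectifiable g /\ joins g x y]].

(* An isometric embedding of a compact interval into X with its quasihyperbolic
   metric, i.e. a geodesic of that space parametrized by its arc length. *)
Definition quasihyperbolic_geodesic g :=
  forall s t, s \in `[lo g, hi g] -> t \in `[lo g, hi g] ->
    quasihyperbolic_dist (g s) (g t) = `|s - t|%:E.

Definition double_cone_arc (a : R) g :=
  is_arc g /\
  forall t, t \in `[lo g, hi g] ->
    (Order.min (length g (lo g) t) (length g t (hi g))
     <= (a * boundary_dist (g t))%:E)%E.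

Definition quasiconvex (a : R) g :=
  (curve_length g <= (a * mdist (g (lo g)) (g (hi g)))%:E)%E.

End curves.

Arguments curve {R} X.

Section spaces.
Context {R : realType} (X : metricType R).

Definition rectifiably_connected :=
  forall x y : X, exists g : curve X, rectifiable g /\ joins g x y.

Definition identity_to_intrinsic_continuous :=
  forall (x : X) (e : R), 0 < e ->
    \forall y \near x, (intrinsic_dist x y < e%:E)%E.

Definition minimally_nice :=
  [/\ locally_compact [set: X], ~ metric_complete X,
      rectifiably_connected & identity_to_intrinsic_continuous].

Definition length_space :=
  forall x y : X, (mdist x y)%:E = intrinsic_dist x y.

Definition john_space := exists a : R, 1 <= a /\
  forall x y : X, exists g : curve X, joins g x y /\ double_cone_arc a g.

Definition uniform_space := exists a : R, 1 <= a /\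
  forall x y : X, exists g : curve X,
    [/\ joins g x y, double_cone_arc a g & quasiconvex a g].

Definition gehring_hayman := exists C : R, 1 <= C /\
  forall (x y : X) (g b : curve X),
    quasihyperbolic_geodesic g -> joins g x y -> joins b x y ->
    (curve_length g <= C%:E * curve_length b)%E.

Definition ball_separation := exists C : R, 1 <= C /\
  forall (x y : X) (g b : curve X),
    quasihyperbolic_geodesic g -> joins g x y -> joins b x y ->
    forall z, trace g z ->
      ball z (C * boundary_dist z) `&` trace b !=set0.

Definition ghs_space :=
  [/\ minimally_nice, length_space, gehring_hayman & ball_separation].

End spaces.

(* Main.v *)
Require Import Defs.
From mathcomp Require Import all_boot all_order all_algebra.
From mathcomp Require Import generic_quotient ring lra.
From mathcomp Require Import all_classical all_reals all_analysis.

Set Implicit Arguments.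
Unset Strict Implicit.
Unset Printing Implicit Defensive.

Import Order.TTheory GRing.Theory Num.Theory.
Import numFieldNormedType.Exports.
Import metricType_numDomainType.

Local Open Scope classical_set_scope.
Local Open Scope quotient_scope.
Local Open Scope ring_scope.

(* A quasihyperbolic geodesic gamma of a uniform space, parametrized by its
   quasihyperbolic length, satisfies k(x, y) <= A (2 N + (d(x, y) / m) / (1 + N))
   for all N >= 0, where m is the smaller of the distances from x and y to the
   boundary; only this sublinearity (rather than the logarithmic bound) is used.
   It forces the distance to the boundary to grow geometrically along gamma
   towards the point where it is maximal, so that the length of each half is
   controlled by its last term: gamma is a double cone arc. The linear case
   N = 0 then gives the Gehring-Hayman inequality, and ball separation is
   witnessed by the endpoints of gamma.

   Conversely, quasihyperbolic geodesics exist, as ultrafilter limits of nearly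
   optimal paths. In a length space the Gehring-Hayman condition makes them and
   their subarcs quasiconvex. If z lies on the geodesic, ball separation yields a
   point w of a John arc near z; an endpoint is at distance at most a d(w) from w,
   hence at distance O(d(z)) from z, and the subarc up to z has length O(d(z)). *)

(** The parameter N is what makes the sublinear bound usable. Along a geodesic, d(x, y) is at most a
    multiple of the elapsed time k(x, y) times the largest boundary distance M in between. If both
    ends have boundary distance at least l M, choosing N = 4 A / l makes the distance term at most
    half of k(x, y). It is absorbed on the left, leaving k(x, y) at most 16 A^2 / l. So the boundary
    distance cannot stay comparable with its maximum for long, and this forces the geometric growth.
    Locally, k and d are compared through a single estimate: if k(x, y) is at most 1/2, then d(x, y)
    is at most 2 k(x, y) times the boundary distance of x. In particular a time step of 1/4 at most
    doubles the boundary distance. *)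

Section real_induction.
Context {R : realType}.
Implicit Types (a b t : R) (P : R -> Prop).

(** The supremum of the times up to which P holds throughout belongs to that set by the first
    hypothesis and equals b by the second. The base case is the first hypothesis at [t = a], where
    no earlier [s] exists. *)
Lemma real_induction a b P : a <= b ->
  (forall t, a <= t <= b -> (forall s, a <= s < t -> P s) -> P t) ->
  (forall t, a <= t < b -> (forall s, a <= s <= t -> P s) ->
    exists2 e, 0 < e & forall s, t < s < t + e -> s <= b -> P s) ->
  forall t, a <= t <= b -> P t.
Proof.
move=> ab closedP openP.
pose S := [set t | a <= t <= b /\ forall s, a <= s <= t -> P s].
have Sa : S a.
  split; first by rewrite lexx.
  move=> s /andP[as_ sa]; apply: closedP; first by lra.
  by move=> r /andP[ar rs]; lra.
have ubS : ubound S b by move=> t [/andP[]].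
have supS : has_sup S by split; [exists a|exists b].
have aT : a <= sup S by apply: ub_le_sup => //; exists b.
have Tb : sup S <= b by apply: ge_sup => //; exists a.
have below s : a <= s -> s < sup S -> P s.
  move=> as_ sT; have /(sup_adherent) : 0 < sup S - s by rewrite subr_gt0.
  move=> /(_ _ supS)[t [_ Pt] st]; apply: Pt.
  by apply/andP; split => //; apply: ltW; rewrite (le_lt_trans _ st)//; lra.
have ST : S (sup S).
  split; first by rewrite aT.
  move=> s /andP[as_]; rewrite le_eqVlt => /predU1P[->|sT]; last exact: below.
  by apply: closedP => [|r /andP[ar rT]]; [rewrite aT|exact: below].
suff <- : sup S = b by move=> t; exact: ST.2.
apply/eqP; rewrite eq_le Tb /= leNgt; apply/negP => Tltb.
have [e e0 Pe] := openP (sup S) (introT andP (conj aT Tltb)) ST.2.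
  pose t := Num.min b (sup S + e / 2).
  have tT : sup S < t by rewrite lt_min Tltb ltrDl divr_gt0.
  have tb : t <= b by rewrite ge_min lexx.
  have te : t < sup S + e by rewrite gt_min ltrD2l ltr_pdivrMr// ltr_pMr// ltr1n orbT.
  have : t <= sup S.
    apply: ub_le_sup; first by exists b.
    split; first by rewrite tb (le_trans aT)// ltW.
    move=> s /andP[as_ st]; have [sT|sT] := leP s (sup S).
      by apply: ST.2; rewrite as_.
    by apply: Pe; rewrite ?sT ?(le_lt_trans st)// (le_trans st).
  by rewrite leNgt tT.
Qed.

End real_induction.

Section metric_space.
Context {R : realType} {X : metricType R}.
Implicit Types (x y z : X) (f : R -> X).

Lemma mdist_eq0 x y : mdist x y <= 0 -> x = y.
Proof. by move=> xy; apply: mdist_positivity; apply: le_anti; rewrite xy mdist_ge0. Qed.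

Lemma within_itv_mdistP f a b : {within `[a, b], continuous f} <->
  forall t, a <= t <= b -> forall e, 0 < e -> exists2 d, 0 < d &
    forall s, a <= s <= b -> `|t - s| < d -> mdist (f t) (f s) < e.
Proof.
rewrite subspace_continuousP; split=> [cf t tab e e0|h t tab].
  have /cvgrPdist_lt/(_ _ e0) := cf t tab.
  move=> /nbhs_ballP[d/= d0 dP]; exists d => // s sab ts.
  exact: dP.
apply/cvgrPdist_lt => e e0; have [d d0 dP] := h t tab e e0.
by apply/nbhs_ballP; exists d => // s ts sab; exact: dP.
Qed.

Lemma lipschitz_within f a b C : 0 <= C ->
  (forall s t, a <= s <= b -> a <= t <= b -> mdist (f s) (f t) <= C * `|s - t|) ->
  {within `[a, b], continuous f}.
Proof.
move=> C0 lip; apply/within_itv_mdistP => t tab e e0.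
exists (e / (C + 1)); first by rewrite divr_gt0// ltr_wpDl.
move=> s sab; rewrite ltr_pdivlMr ?ltr_wpDl// => tse.
apply: le_lt_trans (lip _ _ tab sab) (le_lt_trans _ tse).
by rewrite mulrC ler_wpM2l// lerDl.
Qed.

End metric_space.

(** * Distance to the metric boundary *)

Section boundary.
Context {R : realType} {X : metricType R}.
Implicit Types x y z : X.

Lemma mdist_boundary_has_inf x : (@metric_boundary R X) !=set0 ->
  has_inf [set mdist (embed x) p | p in @metric_boundary R X].
Proof.
move=> [p bp]; split; first by exists (mdist (embed x) p), p.
by exists 0 => _ [q _ <-]; exact: mdist_ge0.
Qed.

Lemma boundary_dist_le x p : metric_boundary p ->
  boundary_dist x <= mdist (embed x) p.
Proof.
move=> bp; apply: ge_inf; last by exists p.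
by exists 0 => _ [q _ <-]; exact: mdist_ge0.
Qed.

Lemma embed_cvg (u : cauchy_seq_of X) x :
  \pi_(completion X) u = embed x -> val u n @[n --> \oo] --> x.
Proof.
move=> ux; apply/cvgrPdist_lt => e e0.
have /cvgrPdist_lt/(_ _ e0) := @cauchy_cvg_completion _ _ u.
by rewrite ux; apply: filterS => n; rewrite embed_isometry.
Qed.

(** Keeps the infimum in [boundary_dist] from being taken over the empty set, where [inf] is a
    default value. *)
Lemma metric_boundary_neq0 : ~ metric_complete X -> (@metric_boundary R X) !=set0.
Proof.
move=> /existsNP[u /not_implyP[cu ul]].
have cu' : cauchy_sequence u by exact/asboolP.
exists (\pi_(completion X) (exist _ u cu' : cauchy_seq_of X)) => -[x _ xu].
by apply: ul; exists x; exact: (embed_cvg (esym xu)).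
Qed.

Lemma boundary_dist_lip x y : ~ metric_complete X ->
  boundary_dist x <= boundary_dist y + mdist x y.
Proof.
move=> /metric_boundary_neq0 b0; rewrite -lerBlDr; apply: lb_le_inf.
  by have [] := mdist_boundary_has_inf y b0.
move=> _ [p bp <-]; rewrite lerBlDr (le_trans (boundary_dist_le x bp))//.
by rewrite (le_trans (metric_triangle _ (embed y) _))// embed_isometry addrC.
Qed.

Lemma compact_nbhs_ball x : locally_compact [set: X] ->
  exists (e : R) (C : set X), [/\ 0 < e, compact C & ball x e `<=` C].
Proof.
move=> /(_ x I)[C]; rewrite withinET => /nbhs_ballP[e /= e0 eC] [cC _].
by exists e, C.
Qed.

(** The radius of a ball inside a compact set is a lower bound: a boundary point closer than that
    would be a limit of points of the compact set, and these have a cluster point in X. *)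
Lemma boundary_dist_gt0 x : locally_compact [set: X] -> ~ metric_complete X ->
  0 < boundary_dist x.
Proof.
move=> lcX /metric_boundary_neq0 b0.
have [e [C [e0 cC eC]]] := compact_nbhs_ball x lcX.
apply: (@lt_le_trans _ _ e) => //; apply: lb_le_inf.
  by have [] := mdist_boundary_has_inf x b0.
move=> _ [p bp <-]; rewrite leNgt; apply/negP => xpe; apply: bp.
pose u := repr p; have up : embed (val u n) @[n --> \oo] --> p.
  by rewrite -[p]reprK; exact: cauchy_cvg_completion.
have uC : \forall n \near \oo, C (val u n).
  have e'0 : 0 < e - mdist (embed x) p by rewrite subr_gt0.
  have /cvgrPdist_lt/(_ _ e'0) := up; apply: filterS => n pn; apply: eC.
  rewrite ballEmdist /= -embed_isometry.
  by rewrite (le_lt_trans (metric_triangle _ p _))//; lra.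
have [q [Cq uq]] := cC (val u @ \oo) _ uC.
exists q => //; apply/esym/mdist_eq0/ler_addgt0Pl => d d0; rewrite addr0.
have d20 : 0 < d / 2 by rewrite divr_gt0.
have /cvgrPdist_lt/(_ _ d20) pd := up.
have [y [/=]] := uq [set y | mdist p (embed y) < d / 2] _ pd (nbhsx_ballx q _ d20).
rewrite ballEmdist /= -embed_isometry => py qy.
rewrite (le_trans (metric_triangle _ (embed y) _))// (splitr d).
by rewrite lerD// ltW// metric_sym.
Qed.

End boundary.

(** * Length of paths in a metric space *)

Section length.
Context {R : realType} {X : metricType R}.
Implicit Types (f : R -> X) (a b c : R) (s : seq R).

Fixpoint chain_length f a s : R :=
  if s is b :: s' then mdist (f a) (f b) + chain_length f b s' else 0.

Lemma metric_variationE f a b s : metric_variation a b f s = chain_length f a s.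
Proof.
rewrite /metric_variation /=.
elim: s a => [|c s IH] a /=; first by rewrite big_nil.
by rewrite big_nat_recl //= IH.
Qed.

Lemma chain_length_cat f a s1 s2 :
  chain_length f a (s1 ++ s2) = chain_length f a s1 + chain_length f (last a s1) s2.
Proof. by elim: s1 a => [|b s IH] a /=; rewrite ?add0r // IH addrA. Qed.

(** Repeated nodes contribute nothing. Chains may therefore be weakly increasing, and nodes can be
    inserted without checking that they are new. *)
Lemma chain_length_strict f a s : path <=%R a s ->
  exists t, [/\ path <%R a t, last a t = last a s & chain_length f a t = chain_length f a s].
Proof.
elim: s a => [|b s IH] a /=; first by exists [::].
rewrite le_eqVlt => /andP[/predU1P[<-|ab] /IH[t [pt lt vt]]].
  by exists t; rewrite mdistxx add0r.
by exists (b :: t); rewrite /= ab pt lt vt.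
Qed.

Lemma chain_le_length f a b s : path <=%R a s -> last a s = b ->
  ((chain_length f a s)%:E <= length f a b)%E.
Proof.
move=> /(chain_length_strict f)[t [pt lt <-]] lb.
apply: ereal_sup_ubound; exists t; last by rewrite metric_variationE.
by split => //; rewrite lt lb.
Qed.

Lemma length_le_chain f a b (C : \bar R) :
  (forall s, path <=%R a s -> last a s = b -> ((chain_length f a s)%:E <= C)%E) ->
  (length f a b <= C)%E.
Proof.
move=> h; apply: ge_ereal_sup => _ [s [ps /eqP ls] <-].
rewrite metric_variationE; apply: h => //.
by apply: sub_path ps => x y; exact: ltW.
Qed.

Lemma mdist_le_length f a b : a <= b -> ((mdist (f a) (f b))%:E <= length f a b)%E.
Proof.
by move=> ab; have := @chain_le_length f a b [:: b]; rewrite /= addr0 ab; apply.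
Qed.

Lemma length_ge0 f a b : a <= b -> (0 <= length f a b)%E.
Proof. by move=> /(mdist_le_length f); apply: le_trans; rewrite lee_fin mdist_ge0. Qed.

Lemma chain_length_split f a b c s : a <= b -> b <= c ->
  path <=%R a s -> last a s = c ->
  exists s1 s2, [/\ path <=%R a s1, last a s1 = b, path <=%R b s2, last b s2 = c &
    chain_length f a s <= chain_length f a s1 + chain_length f b s2].
Proof.
elim: s a => [|x s IH] a ab bc /=.
  move=> _ ac; have ab' : a = b by apply: le_anti; rewrite ab ac bc.
  by exists [::], [::]; rewrite /= addr0; split => //; rewrite -ab'.
move=> /andP[ax xs] xc; have [xb|bx] := leP x b.
  have [s1 [s2 [p1 l1 p2 l2 v]]] := IH x xb bc xs xc.
  by exists (x :: s1), s2; split; rewrite //= ?ax// -addrA lerD2l.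
exists [:: b], (x :: s); rewrite /= addr0 ab (ltW bx); split => //.
by rewrite addrA lerD2r metric_triangle.
Qed.

Lemma lengthD f a b c : a <= b -> b <= c ->
  length f a c = (length f a b + length f b c)%E.
Proof.
move=> ab bc; apply/eqP; rewrite eq_le; apply/andP; split.
  apply: length_le_chain => s ps ls.
  have [s1 [s2 [p1 l1 p2 l2 v]]] := chain_length_split f ab bc ps ls.
  apply: (@le_trans _ _ (chain_length f a s1 + chain_length f b s2)%:E).
    by rewrite lee_fin.
  by rewrite EFinD leeD // chain_le_length.
have h s1 s2 : path <=%R a s1 -> last a s1 = b -> path <=%R b s2 ->
    last b s2 = c -> ((chain_length f a s1)%:E + (chain_length f b s2)%:E <= length f a c)%E.
  move=> p1 l1 p2 l2; rewrite -EFinD -[in chain_length f b _]l1 -chain_length_cat.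
  by apply: chain_le_length; rewrite ?cat_path ?p1 ?last_cat l1.
have h2 s1 : path <=%R a s1 -> last a s1 = b ->
    ((chain_length f a s1)%:E + length f b c <= length f a c)%E.
  move=> p1 l1; rewrite addeC -leeBrDr //; apply: length_le_chain => s2 p2 l2.
  by rewrite leeBrDr // addeC h.
have := length_ge0 f bc; case E : (length f b c) => [r| |] // _.
  by rewrite -leeBrDr //; apply: length_le_chain => s1 p1 l1; rewrite leeBrDr // -E h2.
(* If the second half has infinite length, the one-step chain from a to b already makes the whole
   length infinite. *)
have := h2 [:: b]; rewrite /= ab => /(_ isT erefl); rewrite E addey // leye_eq.
by move=> /eqP ->; exact: leey.
Qed.

Lemma length_lipschitz f a b (C : R) :
  (forall s t : R, a <= s -> s <= t -> t <= b -> mdist (f s) (f t) <= C * (t - s)) ->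
  (length f a b <= (C * (b - a))%:E)%E.
Proof.
move=> lip; apply: length_le_chain => s; rewrite lee_fin.
elim: s a lip => [|c s IH] a lip /=; first by move=> _ ->; rewrite subrr mulr0.
move=> /andP[ac cs] lb; have cb : c <= b.
  by rewrite -lb; move: cs; clear; elim: s c => //= d s IH c /andP[/le_trans + /IH]; apply.
have -> : C * (b - a) = C * (c - a) + C * (b - c) by lra.
rewrite lerD ?lip ?IH// => u v cu; apply: lip; exact: le_trans cu.
Qed.

(** Continuity of arc length from the right. Take a partition of [t, b] within e / 2 of the length;
    moving its first node from t to a nearby t' before the next node loses at most d(f t, f t') < e
    / 2, so [t', b] carries all but e of the length. *)
Lemma length_right_small f a b (e : R) : {within `[a, b], continuous f} ->
  (length f a b < +oo)%E -> forall t, a <= t -> t < b -> 0 < e ->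
  exists2 d, 0 < d & forall t', t <= t' -> t' < t + d -> t' <= b ->
    (length f t t' <= e%:E)%E.
Proof.
move=> cf fin t at_ tb e0.
have fin_t : length f t b \is a fin_num.
  rewrite ge0_fin_numE ?length_ge0 // ?ltW//; apply: le_lt_trans fin.
  by rewrite (lengthD f at_ (ltW tb)) leeDr // length_ge0.
have e20 : 0 < e / 2 by rewrite divr_gt0.
have [_ [s [ps ls] <-]] := ub_ereal_sup_adherent e20 fin_t.
rewrite metric_variationE -/(length f t b).
case: s ps ls => [_ /eqP/= tb'|i s /= /andP[ti ps] /eqP lb vs].
  by move: tb; rewrite tb' ltxx.
move/within_itv_mdistP : cf => /(_ t _ _ e20)[]; first by rewrite at_ ltW.
move=> d d0 cd; exists (Num.min d (i - t)); first by rewrite lt_min d0 subr_gt0.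
move=> t' tt' t'd t'b.
have [t'd1 t'i] : t' < t + d /\ t' < i.
  split; apply: (lt_le_trans t'd); rewrite ?lerD2l ?ge_min ?lexx//.
  by rewrite -lerBrDl ge_min lexx orbT.
have := lengthD f tt' t'b; move=> E.
have fin1 : length f t' b \is a fin_num.
  rewrite ge0_fin_numE ?length_ge0 //; apply: (@le_lt_trans _ _ (length f t b)).
    by rewrite E leeDr // length_ge0.
  by rewrite ltey_eq fin_t.
have fin2 : length f t t' \is a fin_num.
  rewrite ge0_fin_numE ?length_ge0 //; apply: (@le_lt_trans _ _ (length f t b)).
    by rewrite E leeDl // length_ge0.
  by rewrite ltey_eq fin_t.
have c1 : ((chain_length f t' (i :: s))%:E <= length f t' b)%E.
  apply: chain_le_length => //=; rewrite (ltW t'i).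
  by apply: sub_path ps => x y; exact: ltW.
have c2 : mdist (f t) (f t') < e / 2.
  by apply: cd; rewrite ?(le_trans at_ tt')// distrC ger0_norm ?subr_ge0// ltrBlDl.
have c3 := metric_triangle (f t) (f t') (f i).
move: vs c1; rewrite E -(fineK fin1) -(fineK fin2) -!EFinD !lte_fin !lee_fin /=.
lra.
Qed.

Lemma length_left_small f a b (e : R) : {within `[a, b], continuous f} ->
  (length f a b < +oo)%E -> forall t, a < t -> t <= b -> 0 < e ->
  exists2 d, 0 < d & forall t', t - d < t' -> t' <= t -> a <= t' ->
    (length f t' t <= e%:E)%E.
Proof.
move=> cf fin t at_ tb e0.
have fin_t : length f a t \is a fin_num.
  rewrite ge0_fin_numE ?length_ge0 // ?ltW//; apply: le_lt_trans fin.
  by rewrite (lengthD f (ltW at_) tb) leeDl // length_ge0.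
have e20 : 0 < e / 2 by rewrite divr_gt0.
have [_ [s [ps ls] <-]] := ub_ereal_sup_adherent e20 fin_t.
rewrite metric_variationE -/(length f a t).
case/lastP: s ps ls => [_ /eqP/= tb'|s i].
  by move: at_; rewrite tb' ltxx.
rewrite rcons_path last_rcons -cats1 chain_length_cat /= addr0.
move=> /andP[ps pi] /eqP it; subst i; set p := last a s in pi *; move=> vs.
have ap : a <= p.
  by rewrite /p; move: ps; clear; elim: s a => //= d s IH c /andP[/ltW/le_trans + /IH]; apply.
move/within_itv_mdistP : cf => /(_ t _ _ e20)[]; first by rewrite tb ltW.
move=> d d0 cd; exists (Num.min d (t - p)); first by rewrite lt_min d0 subr_gt0.
move=> t' t'd t't at'.
have [t'd1 pt'] : t - d < t' /\ p < t'.
  split; apply: (le_lt_trans _ t'd); first by rewrite lerD2l lerN2 ge_min lexx.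
  by rewrite lerBrDl -lerBrDr ge_min lexx orbT.
have := lengthD f at' t't; move=> E.
have fin1 : length f a t' \is a fin_num.
  rewrite ge0_fin_numE ?length_ge0 //; apply: (@le_lt_trans _ _ (length f a t)).
    by rewrite E leeDl // length_ge0.
  by rewrite ltey_eq fin_t.
have fin2 : length f t' t \is a fin_num.
  rewrite ge0_fin_numE ?length_ge0 //; apply: (@le_lt_trans _ _ (length f a t)).
    by rewrite E leeDr // length_ge0.
  by rewrite ltey_eq fin_t.
have c1 : ((chain_length f a (rcons s t'))%:E <= length f a t')%E.
  apply: chain_le_length; rewrite ?last_rcons// rcons_path -/p (ltW pt') andbT.
  by apply: sub_path ps => x y; exact: ltW.
have c2 : mdist (f t) (f t') < e / 2.
  apply: cd; first by rewrite at' (le_trans t't tb).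
  by rewrite ger0_norm ?subr_ge0// ltrBlDr -ltrBlDl.
have c3 := metric_triangle (f p) (f t') (f t).
rewrite metric_sym in c2.
move: vs c1; rewrite -cats1 chain_length_cat /= addr0 -/p E.
rewrite -(fineK fin1) -(fineK fin2) -!EFinD !lte_fin !lee_fin /=.
lra.
Qed.

End length.

(** * Arc-length parametrization *)

Section arclength.
Context {R : realType} {X : metricType R}.
Implicit Types (g : @curve R X).

Definition travelled g (t : R) : R := fine (length g (lo g) t).

Definition total_length g : R := fine (curve_length g).

Definition arrival g (s : R) : R :=
  inf [set t | t \in `[lo g, hi g] /\ (s%:E <= length g (lo g) t)%E].

Section rectifiable_curve.
Context (g : @curve R X) (rg : rectifiable g).

Local Notation V := (travelled g).
Local Notation L := (total_length g).
Local Notation h := (arclength_param g).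

Lemma length_sub_lty s t : lo g <= s -> s <= t -> t <= hi g -> (length g s t < +oo)%E.
Proof.
move=> los st thi; apply: le_lt_trans rg; rewrite /curve_length.
rewrite (lengthD g los (le_trans st thi)) (lengthD g st thi) addeCA.
by rewrite leeDl// adde_ge0 ?length_ge0.
Qed.

Lemma length_travelled s t : lo g <= s -> s <= t -> t <= hi g ->
  length g s t = (V t - V s)%:E.
Proof.
move=> los st thi; have fn a b : lo g <= a -> a <= b -> b <= hi g ->
    length g a b \is a fin_num.
  by move=> la ab bh; rewrite ge0_fin_numE ?length_ge0// length_sub_lty.
have shi := le_trans st thi; have lot := le_trans los st.
rewrite /travelled (lengthD g los st) fineD ?fn //.
by rewrite addrC addKr fineK// fn.
Qed.

Lemma total_lengthE : (total_length g)%:E = curve_length g.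
Proof. by rewrite fineK // ge0_fin_numE // length_ge0 // lo_le_hi. Qed.

Lemma travelled_lo : V (lo g) = 0.
Proof.
have := length_travelled (lexx _) (lexx _) (lo_le_hi g); rewrite subrr => E.
by rewrite /travelled E.
Qed.

Lemma travelled_hi : V (hi g) = L. Proof. by []. Qed.

Lemma total_length_ge0 : 0 <= L.
Proof. by rewrite fine_ge0 // length_ge0 // lo_le_hi. Qed.

Lemma travelled_mono s t : lo g <= s -> s <= t -> t <= hi g -> V s <= V t.
Proof.
move=> los st thi; have := length_ge0 g st.
by rewrite length_travelled // lee_fin subr_ge0.
Qed.

Lemma mdist_travelled s t : lo g <= s -> s <= t -> t <= hi g ->
  mdist (g s) (g t) <= V t - V s.
Proof.
by move=> los st thi; have := mdist_le_length g st; rewrite length_travelled.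
Qed.

Lemma arrival_set s :
  [set t | t \in `[lo g, hi g] /\ (s%:E <= length g (lo g) t)%E] =
  [set t | lo g <= t <= hi g /\ s <= V t].
Proof.
apply/seteqP; split => t /=; rewrite in_itv /= => -[/andP[lt th]];
  rewrite (length_travelled (lexx _) lt th) travelled_lo subr0 lee_fin => st;
  by split => //; rewrite lt th.
Qed.

Lemma arrival_has_inf s : s <= L ->
  has_inf [set t | lo g <= t <= hi g /\ s <= V t].
Proof.
move=> sL; split; first by exists (hi g); rewrite /= lo_le_hi lexx travelled_hi.
by exists (lo g) => t [/andP[]].
Qed.

Lemma arrival_itv s : s <= L -> lo g <= arrival g s <= hi g.
Proof.
move=> /arrival_has_inf[ne bd]; rewrite /arrival arrival_set; apply/andP; split.
  by apply: lb_le_inf => // t [/andP[]].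
have [t /[dup] tS [/andP[_ th] _]] := ne.
by apply: le_trans th; exact: ge_inf.
Qed.

Lemma arrival_le s t : lo g <= t <= hi g -> s <= V t -> arrival g s <= t.
Proof.
move=> tI st; rewrite /arrival arrival_set; apply: ge_inf => //.
by exists (lo g) => u [/andP[]].
Qed.

(** By continuity of arc length: points just left of the infimum have travelled less than s, and
    some points just right of it have travelled at least s. At an endpoint of the parameter interval
    one side is missing and the bounds on s take over. *)
Lemma travelled_arrival s : 0 <= s <= L -> V (arrival g s) = s.
Proof.
move=> /andP[s0 sL]; have /andP[la ah] := arrival_itv sL.
set T := arrival g s in la ah *.
apply/le_anti/andP; split; apply/ler_addgt0Pl => e e0.
  move: la; rewrite le_eqVlt => /predU1P[<-|la].
    by rewrite travelled_lo addr_ge0// ltW.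
  have [d d0 hd] := length_left_small (path_of_continuous (c := g)) rg la ah e0.
  pose t := Num.max (lo g) (T - d / 2).
  have tT : t < T by rewrite gt_max la ltrBlDr ltrDl divr_gt0.
  have lt : lo g <= t by rewrite le_max lexx.
  have dt : T - d < t.
    by rewrite lt_max ltrD2l ltrN2 ltr_pdivrMr // ltr_pMr // ltr1n orbT.
  have := hd t dt (ltW tT) lt; rewrite length_travelled ?(ltW tT)// lee_fin.
  suff : V t < s by lra.
  rewrite ltNge; apply/negP => st.
  have := @arrival_le s t; rewrite lt (le_trans (ltW tT) ah) => /(_ isT st).
  by rewrite leNgt tT.
move: ah; rewrite le_eqVlt => /predU1P[->|ah].
  by rewrite travelled_hi; lra.
have [d d0 hd] := length_right_small (path_of_continuous (c := g)) rg la ah e0.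
have := inf_adherent d0 (arrival_has_inf sL).
rewrite -arrival_set -/(arrival g s) -/T arrival_set => -[t [/andP[lt th] st] tTd].
have Tt : T <= t by apply: arrival_le => //; rewrite lt th.
have := hd t Tt tTd th; rewrite length_travelled // lee_fin; lra.
Qed.

Lemma arclength_paramE s : h s = g (arrival g s). Proof. by []. Qed.

Lemma arclength_param_travelled t : lo g <= t <= hi g -> h (V t) = g t.
Proof.
move=> /[dup] tI /andP[lt th].
have V0 : 0 <= V t by rewrite -travelled_lo travelled_mono.
have VL : V t <= L by rewrite -travelled_hi travelled_mono.
have at_ : arrival g (V t) <= t by exact: arrival_le.
have /andP[la ah] := arrival_itv VL.
apply: mdist_eq0; rewrite arclength_paramE.
rewrite (le_trans (mdist_travelled la at_ th)) // travelled_arrival ?V0//.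
by rewrite subrr.
Qed.

Lemma arclength_param0 : h 0 = g (lo g).
Proof. by rewrite -travelled_lo arclength_param_travelled // lexx lo_le_hi. Qed.

Lemma arclength_paramL : h L = g (hi g).
Proof. by rewrite -travelled_hi arclength_param_travelled // lexx lo_le_hi. Qed.

Lemma arclength_param_lip s t : 0 <= s -> s <= t -> t <= L ->
  mdist (h s) (h t) <= t - s.
Proof.
move=> s0 st tL; have sL := le_trans st tL; have t0 := le_trans s0 st.
have /andP[la ah] := arrival_itv sL; have /andP[la' ah'] := arrival_itv tL.
have at_ : arrival g s <= arrival g t.
  by apply: arrival_le; rewrite ?la'// travelled_arrival ?t0.
by rewrite (le_trans (mdist_travelled la at_ ah')) // !travelled_arrival ?s0 ?t0.
Qed.

End rectifiable_curve.
End arclength.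

(** * Primitives *)

Section primitives.
Context {R : realType}.
Implicit Types (F G A B : R -> R) (a b c s t u : R).

(** Mean value bounds in place of derivatives. The two directions are kept apart because a
    reparametrized cost, such as [H \o travelled g] in [quasihyperbolic_dist_le], is only shown to
    satisfy one of them. *)
Definition upper_primitive F a b A := forall s t, a <= s -> s <= t -> t <= b ->
  forall M : R, (forall u, s <= u <= t -> F u <= M) -> A t - A s <= M * (t - s).

Definition lower_primitive F a b A := forall s t, a <= s -> s <= t -> t <= b ->
  forall m : R, (forall u, s <= u <= t -> m <= F u) -> m * (t - s) <= A t - A s.

Definition primitive F a b A := upper_primitive F a b A /\ lower_primitive F a b A.

(** Near each point F oscillates by at most e, so there A outgrows B at rate at most e; real
    induction adds up these local errors. *)
Lemma primitive_le F a b A B : a <= b -> {within `[a, b], continuous F} ->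
  upper_primitive F a b A -> lower_primitive F a b B -> A b - A a <= B b - B a.
Proof.
move=> ab /(@within_itv_mdistP R R^o) cF uA lB.
have step (e s : R) : 0 < e -> a <= s -> s <= b -> exists2 d : R, 0 < d & forall t u,
    s - d < t -> t <= u -> u < s + d -> a <= t -> t <= s -> s <= u -> u <= b ->
    A u - A t <= B u - B t + e * (u - t).
  move=> e0 as_ sb; have e20 : 0 < e / 2 by rewrite divr_gt0.
  have := cF s; rewrite as_ sb => /(_ isT _ e20)[d d0 dF]; exists d => // t u.
  move=> st tu us at_ ts su ub.
  have Fs v : t <= v <= u -> F s - e / 2 <= F v <= F s + e / 2.
    move=> /andP[tv vu]; have : `|F v - F s| < e / 2.
      by apply: dF; [lra|rewrite ltr_norml; lra].
    by rewrite ltr_norml; lra.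
  have := uA t u at_ tu ub _ (fun v tvu => proj2 (andP (Fs v tvu))).
  have := lB t u at_ tu ub _ (fun v tvu => proj1 (andP (Fs v tvu))).
  rewrite [e in X in _ -> _ -> X]splitr; lra.
apply/ler_addgt0Pr => e e0.
(* Error allowed per unit of length; the [+ 1] covers [a = b]. *)
pose k := e / (b - a + 1).
have ba1 : 0 < b - a + 1 by lra.
have k0 : 0 < k by rewrite divr_gt0.
suff h t : a <= t <= b -> A t - A a <= B t - B a + k * (t - a).
  have := h b; rewrite ab lexx => /(_ isT) /le_trans; apply; rewrite lerD2l.
  by rewrite /k mulrAC ler_pdivrMr// ler_wpM2l ?(ltW e0)// ; lra.
move: t; apply: real_induction => //.
  move=> t /andP[at_ tb] h; have [d d0 dP] := step k t k0 at_ tb.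
  move: at_; rewrite le_eqVlt => /predU1P[<-|at_]; first by rewrite !subrr mulr0 addr0.
  pose s := Num.max a (t - d / 2).
  have sdt : t - d < s /\ s < t /\ a <= s.
    split; first by rewrite lt_max; apply/orP; right; lra.
    by split; [rewrite gt_max at_; lra|rewrite le_max lexx].
  move: sdt => [ds [st as_]].
  have := dP s t ds (ltW st) ltac:(lra) as_ (ltW st) (lexx _) tb.
  by have := h s (introT andP (conj as_ st)); lra.
move=> t /andP[at_ tb] h; have [d d0 dP] := step k t k0 at_ (ltW tb).
exists d => // s /andP[ts std] sb.
have := dP t s ltac:(lra) (ltW ts) std at_ (lexx _) (ltW ts) sb.
by have := h t (introT andP (conj at_ (lexx t))); lra.
Qed.

(** The bridge from the Lebesgue integral in [line_integral] to mean value bounds. *)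
Lemma primitive_exists F a b : a <= b -> {within `[a, b], continuous F} ->
  exists2 G, primitive F a b G &
    (\int[@lebesgue_measure R]_(s in `[a, b]) (F s)%:E = (G b - G a)%:E)%E.
Proof.
move=> ab cF; pose mu := @lebesgue_measure R.
have intF (c d : R) : a <= c -> d <= b -> mu.-integrable `[c, d] (EFin \o F).
  move=> ac db; apply: continuous_compact_integrable; first exact: segment_compact.
  apply: continuous_subspaceW cF => x /=; rewrite !in_itv /= => /andP[cx xd].
  by rewrite (le_trans ac cx) (le_trans xd db).
pose G t := \int[mu]_(x in `[a, t]) F x.
have GB (s t : R) : a <= s -> s <= t -> t <= b -> G t - G s = \int[mu]_(x in `[s, t]) F x.
  move=> as_ st tb; rewrite /G Rintegral_itvB ?bnd_simp// ?intF//.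
  by rewrite Rintegral_itv_obnd_cbnd//; apply: integrableS (intF s t as_ tb) => //;
    exact: subset_itv_oc_cc.
have cst (s t m : R) : s <= t -> \int[mu]_(x in `[s, t]) m = m * (t - s).
  move=> st; rewrite Rintegral_cst//=; congr (_ * _).
  rewrite /mu lebesgue_measure_itv /= lte_fin.
  by move: st; rewrite le_eqVlt => /predU1P[->|->]; rewrite ?ltxx ?subrr.
have intc (s t m : R) : mu.-integrable `[s, t] (EFin \o (fun=> m)).
  apply: continuous_compact_integrable; first exact: segment_compact.
  by apply: continuous_subspaceT => x; exact: cvg_cst.
exists G.
  split=> s t as_ st tb M FM; rewrite GB // -(cst s t M st).
    apply: le_Rintegral; [by []|exact: intF|exact: intc|].
    by move=> x /=; rewrite in_itv /=; exact: FM.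
  apply: le_Rintegral; [by []|exact: intc|exact: intF|].
  by move=> x /=; rewrite in_itv /=; exact: FM.
rewrite GB // /Rintegral fineK //; apply: integrable_fin_num => //.
exact: intF.
Qed.

Lemma primitive_reverse F L G : primitive F 0 L G ->
  primitive (fun s => F (L - s)) 0 L (fun s => - G (L - s)).
Proof.
move=> [uG lG]; split=> s t s0 st tL M h.
  have := uG (L - t) (L - s) ltac:(lra) ltac:(lra) ltac:(lra) M.
  have -> : L - s - (L - t) = t - s by lra.
  move=> H; rewrite opprK [- _ + _]addrC; apply: H => u /andP[u1 u2].
  by have := h (L - u); rewrite subKr; apply; lra.
have := lG (L - t) (L - s) ltac:(lra) ltac:(lra) ltac:(lra) M.
have -> : L - s - (L - t) = t - s by lra.
move=> H; rewrite opprK [- _ + _]addrC; apply: H => u /andP[u1 u2].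
by have := h (L - u); rewrite subKr; apply; lra.
Qed.

Lemma primitive_shift F L G a b : primitive F 0 L G -> 0 <= a -> b <= L ->
  primitive (fun s => F (a + s)) 0 (b - a) (fun s => G (a + s)).
Proof.
move=> [uG lG] a0 bL; split=> s t s0 st tL M h.
  have := uG (a + s) (a + t) ltac:(lra) ltac:(lra) ltac:(lra) M.
  have -> : a + t - (a + s) = t - s by lra.
  apply=> u /andP[u1 u2].
  have -> : u = a + (u - a) by lra.
by apply: h; lra.
have := lG (a + s) (a + t) ltac:(lra) ltac:(lra) ltac:(lra) M.
have -> : a + t - (a + s) = t - s by lra.
apply=> u /andP[u1 u2].
have -> : u = a + (u - a) by lra.
by apply: h; lra.
Qed.

Lemma primitive_cat F L1 L2 G1 G2 : 0 <= L1 -> 0 <= L2 ->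
  primitive F 0 L1 G1 -> primitive (fun s => F (L1 + s)) 0 L2 G2 ->
  primitive F 0 (L1 + L2)
    (fun s => if s <= L1 then G1 s else G1 L1 - G2 0 + G2 (s - L1)).
Proof.
move=> L10 L20 [u1 l1] [u2 l2].
have upper s t : 0 <= s -> s <= t -> t <= L2 -> forall M : R,
    (forall u, L1 + s <= u <= L1 + t -> F u <= M) -> G2 t - G2 s <= M * (t - s).
  by move=> s0 st tL M h; apply: u2 => // u ?; apply: h; lra.
have lower s t : 0 <= s -> s <= t -> t <= L2 -> forall m : R,
    (forall u, L1 + s <= u <= L1 + t -> m <= F u) -> m * (t - s) <= G2 t - G2 s.
  by move=> s0 st tL M h; apply: l2 => // u ?; apply: h; lra.
split=> s t s0 st tL M h; case: (leP s L1) => sL1; case: (leP t L1) => tL1.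
- exact: u1.
- have := u1 s L1 s0 sL1 (lexx _) M (fun u hu => h u ltac:(lra)).
  have := upper 0 (t - L1) (lexx _) ltac:(lra) ltac:(lra) M (fun u hu => h u ltac:(lra)).
  lra.
- lra.
- have := upper (s - L1) (t - L1) ltac:(lra) ltac:(lra) ltac:(lra) M (fun u hu => h u ltac:(lra)).
  lra.
- exact: l1.
- have := l1 s L1 s0 sL1 (lexx _) M (fun u hu => h u ltac:(lra)).
  have := lower 0 (t - L1) (lexx _) ltac:(lra) ltac:(lra) M (fun u hu => h u ltac:(lra)).
  lra.
- lra.
- have := lower (s - L1) (t - L1) ltac:(lra) ltac:(lra) ltac:(lra) M (fun u hu => h u ltac:(lra)).
  lra.
Qed.

End primitives.

(** * The quasihyperbolic distance *)

Section quasihyperbolic.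
Context {R : realType} {X : metricType R}.
Implicit Types (x y z : X) (h : R -> X) (G : R -> R).

(** Speed at most one, rather than exactly one: the condition survives gluing and reversal without
    reparametrization, and a slower pace can only raise the cost. *)
Definition one_lipschitz h (L : R) := forall s t, 0 <= s -> s <= t -> t <= L ->
  mdist (h s) (h t) <= t - s.

Definition qh_density h (s : R) : R := (boundary_dist (h s))^-1.

(* The cost of a path is read off a primitive of the density rather than an
   integral: restriction, reversal and concatenation of paths then need no
   change of variables. *)
Definition qh_path x y (c : R) := exists L h G,
  [/\ 0 <= L, one_lipschitz h L, h 0 = x, h L = y &
      primitive (qh_density h) 0 L G /\ c = G L - G 0].

Definition qh_dist x y : R := fine (quasihyperbolic_dist x y).

Context (lcX : locally_compact [set: X]).
Context (incX : ~ metric_complete X).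

Let delta_gt0 x : 0 < boundary_dist x := boundary_dist_gt0 x lcX incX.

Let delta_lip x y : boundary_dist x <= boundary_dist y + mdist x y :=
  boundary_dist_lip x y incX.

Lemma one_lipschitz_continuous h L : one_lipschitz h L ->
  {within `[0, L], continuous h}.
Proof.
move=> lip; apply: (@lipschitz_within _ _ _ _ _ 1) => // s t.
move=> /andP[s0 sL] /andP[t0 tL]; rewrite mul1r; case: (leP s t) => [|/ltW] st.
  by rewrite distrC ger0_norm ?subr_ge0// lip.
by rewrite ger0_norm ?subr_ge0// metric_sym lip.
Qed.

Lemma continuous_boundary_dist : continuous (@boundary_dist R X).
Proof.
move=> x; apply/(@cvgrPdist_lt _ R^o) => e e0; apply/nbhs_ballP; exists e => // y.
rewrite ballEmdist /= => xy; rewrite ltr_norml.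
have := delta_lip x y; have := delta_lip y x; rewrite (metric_sym y x); lra.
Qed.

Lemma qh_density_continuous h L : one_lipschitz h L ->
  {within `[0, L], continuous (qh_density h)}.
Proof.
move=> /one_lipschitz_continuous/subspace_continuousP ch.
apply/subspace_continuousP => t tL; apply: cvgV; first by rewrite gt_eqF.
apply: (@cvg_comp _ _ _ h (@boundary_dist R X)); first exact: ch.
exact: continuous_boundary_dist.
Qed.

Lemma one_lipschitz_arclength_param (g : @curve R X) : rectifiable g ->
  one_lipschitz (arclength_param g) (total_length g).
Proof. by move=> rg s t; exact: arclength_param_lip. Qed.

Lemma line_integral_primitive (g : @curve R X) : rectifiable g ->
  exists2 G, primitive (qh_density (arclength_param g)) 0 (total_length g) G &
    line_integral (fun z => (boundary_dist z)^-1) g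
    = (G (total_length g) - G 0)%:E.
Proof.
move=> rg; apply: primitive_exists; first exact: total_length_ge0.
exact/qh_density_continuous/one_lipschitz_arclength_param.
Qed.

Lemma qh_path_curve (g : @curve R X) x y : rectifiable g -> joins g x y ->
  exists2 c, qh_path x y c &
    line_integral (fun z => (boundary_dist z)^-1) g = c%:E.
Proof.
move=> rg [gx gy]; have [G pG ->] := line_integral_primitive rg.
eexists; last reflexivity.
exists (total_length g), (arclength_param g), G; split => //.
- exact: total_length_ge0.
- exact: one_lipschitz_arclength_param.
- by rewrite arclength_param0.
- by rewrite arclength_paramL.
Qed.

(* Reparametrizing a one-Lipschitz path by arc length can only decrease its
   cost, since the length travelled by time s increases by at most t - s on [s, t]. *)
Lemma quasihyperbolic_dist_le x y c : qh_path x y c ->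
  (quasihyperbolic_dist x y <= c%:E)%E.
Proof.
move=> [L [h [G [L0 lip h0 hL [pG ->]]]]].
pose g := Curve L0 (one_lipschitz_continuous lip).
have len s t : 0 <= s -> s <= t -> t <= L -> (length h s t <= (t - s)%:E)%E.
  move=> s0 st tL; rewrite -[t - s]mul1r; apply: length_lipschitz => u v su uv vt.
  by rewrite mul1r lip// ?(le_trans s0)// (le_trans vt).
have rg : rectifiable g by apply: (le_lt_trans (len _ _ _ _ _)); rewrite ?ltry.
have Vlip s t : 0 <= s -> s <= t -> t <= L -> travelled g t - travelled g s <= t - s.
  by move=> s0 st tL; have := len s t s0 st tL; rewrite -[h]/(g : R -> X) length_travelled.
have [H pH intH] := line_integral_primitive rg.
have : (quasihyperbolic_dist x y <= line_integral (fun z => (boundary_dist z)^-1%R) g)%E.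
  by apply: ereal_inf_lbound; exists g.
move=> /le_trans; apply; rewrite intH lee_fin.
have E0 : travelled g 0 = 0 by exact: (travelled_lo rg).
have := @primitive_le _ (qh_density h) 0 L (H \o travelled g) G L0.
rewrite /= E0; apply; [exact: qh_density_continuous| |exact: pG.2].
move=> s t s0 st tL M FM /=.
have V0 : 0 <= travelled g s.
  by rewrite -[leLHS]E0; apply: travelled_mono => //; exact: le_trans tL.
have Vst : travelled g s <= travelled g t by apply: travelled_mono.
have VL : travelled g t <= total_length g.
  by rewrite -travelled_hi; apply: travelled_mono => //; exact: le_trans st.
have := pH.1 _ _ V0 Vst VL M; move=> /(_ _)/le_trans; apply; last first.
  apply: ler_wpM2l; last exact: Vlip.
  apply: le_trans (FM s _); last by rewrite lexx.
  by rewrite /qh_density invr_ge0 ltW.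
move=> u /andP[su ut].
have uL : 0 <= u <= total_length g by rewrite (le_trans V0)// (le_trans ut).
have /andP[la ah] := arrival_itv (g := g) rg (proj2 (andP uL)).
have Va := travelled_arrival rg uL.
(* Should the first time at which length u is reached fall outside [s, t], the nearer endpoint has
   travelled the same length by monotonicity. *)
have [v vst Vv] : exists2 v, s <= v <= t & travelled g v = u.
  case: (leP s (arrival g u)) => [sa|/ltW sa].
    case: (leP (arrival g u) t) => [at_|/ltW ta]; first by exists (arrival g u); rewrite ?sa.
    exists t; rewrite ?st ?lexx//; apply/le_anti; rewrite ut andbT -Va.
    by apply: travelled_mono => //; exact: le_trans st.
  exists s; rewrite ?st ?lexx//; apply/le_anti; rewrite su /= -Va.
  by apply: travelled_mono => //; exact: le_trans tL.
rewrite /qh_density -Vv arclength_param_travelled//; first exact: FM.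
by move: vst => /andP[sv vt]; rewrite /= (le_trans s0 sv) (le_trans vt tL).
Qed.

Context (rcX : rectifiably_connected X).

Lemma qh_distE x y : quasihyperbolic_dist x y = (qh_dist x y)%:E.
Proof.
rewrite fineK// ge0_fin_numE.
  have [g [rg gxy]] := rcX x y; have [c xyc _] := qh_path_curve rg gxy.
  by apply: le_lt_trans (quasihyperbolic_dist_le xyc) _; rewrite ltry.
apply: le_ereal_inf_tmp => _ [g [rg gxy] <-]; apply: integral_ge0 => s _.
by rewrite lee_fin invr_ge0 ltW.
Qed.

Lemma qh_dist_le x y c : qh_path x y c -> qh_dist x y <= c.
Proof. by move=> /quasihyperbolic_dist_le; rewrite qh_distE. Qed.

Lemma qh_dist_approx x y e : 0 < e -> exists2 c, qh_path x y c & c < qh_dist x y + e.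
Proof.
move=> e0; have := qh_distE x y => E.
have fn : quasihyperbolic_dist x y \is a fin_num by rewrite E.
have [_ [g [rg gxy] <-]] := lb_ereal_inf_adherent e0 fn.
rewrite -/(quasihyperbolic_dist x y) E; have [c xyc ->] := qh_path_curve rg gxy.
by rewrite -EFinD lte_fin; exists c.
Qed.

Lemma qh_path_sub h L G s t : one_lipschitz h L -> primitive (qh_density h) 0 L G ->
  0 <= s -> s <= t -> t <= L -> qh_path (h s) (h t) (G t - G s).
Proof.
move=> lip pG s0 st tL.
exists (t - s), (fun u => h (s + u)), (fun u => G (s + u)); split.
- by rewrite subr_ge0.
- move=> u v u0 uv vt; have := lip (s + u) (s + v).
  have -> : s + v - (s + u) = v - u by lra.
  by apply; lra.
- by rewrite addr0.
- by rewrite addrC subrK.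
- split; first exact: (primitive_shift pG).
  by rewrite addr0 [s + _]addrC subrK.
Qed.

Lemma qh_path_sym x y c : qh_path x y c -> qh_path y x c.
Proof.
move=> [L [h [G [L0 lip h0 hL [pG cE]]]]].
exists L, (fun s => h (L - s)), (fun s => - G (L - s)); split => //.
- move=> s t s0 st tL; rewrite metric_sym.
  by have := lip (L - t) (L - s) ltac:(lra) ltac:(lra) ltac:(lra); lra.
- by rewrite subr0.
- by rewrite subrr.
- by split; [exact: (primitive_reverse pG)|rewrite subrr subr0 opprK addrC].
Qed.

Lemma qh_path_trans y x z c1 c2 : qh_path x y c1 -> qh_path y z c2 ->
  qh_path x z (c1 + c2).
Proof.
move=> [L1 [h1 [G1 [L10 lip1 h10 h1L [pG1 ->]]]]].
move=> [L2 [h2 [G2 [L20 lip2 h20 h2L [pG2 ->]]]]].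
pose h s := if s <= L1 then h1 s else h2 (s - L1).
have hl s : 0 <= s -> h (L1 + s) = h2 s.
  rewrite le_eqVlt /h => /predU1P[<-|s0]; first by rewrite addr0 lexx h1L h20.
  by rewrite leNgt ltrDl s0 /= addrC addKr.
have h1E s : s <= L1 -> h s = h1 s by rewrite /h => ->.
have ext (F F' : R -> R) L G : (forall s, 0 <= s <= L -> F s = F' s) ->
    primitive F 0 L G -> primitive F' 0 L G.
  move=> FF' [uG lG]; split=> s t s0 st tL M FM.
    by apply: uG => // u /[dup] /FM uM /andP[su ut]; rewrite FF'; [exact: uM|lra].
  by apply: lG => // u /[dup] /FM uM /andP[su ut]; rewrite FF'; [exact: uM|lra].
have pG1' : primitive (qh_density h) 0 L1 G1.
  by apply: ext pG1 => s /andP[s0 sL]; rewrite /qh_density h1E.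
have pG2' : primitive (fun s => qh_density h (L1 + s)) 0 L2 G2.
  by apply: ext pG2 => s /andP[s0 sL]; rewrite /qh_density hl.
have pG := primitive_cat L10 L20 pG1' pG2'.
exists (L1 + L2), h; eexists; split; last first.
- split; first exact: pG.
  rewrite /= L10; case: (leP (L1 + L2) L1) => L12.
    have -> : L2 = 0 by lra.
    by rewrite addr0 subrr addr0.
  by rewrite [L1 + L2]addrC addrK; lra.
- by rewrite hl.
- by rewrite h1E.
- move=> s t s0 st tL; rewrite /h; case: (leP t L1) => tL1.
    by rewrite (le_trans st tL1) lip1.
  case: (leP s L1) => sL1; last first.
    by have := lip2 (s - L1) (t - L1) ltac:(lra) ltac:(lra) ltac:(lra); lra.
  have := lip1 s L1 s0 sL1 (lexx _).
  have := lip2 0 (t - L1) (lexx _) ltac:(lra) ltac:(lra).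
  rewrite h20 h1L; have := metric_triangle (h1 s) y (h2 (t - L1)); lra.
- by rewrite addr_ge0.
Qed.

Lemma qh_path_refl x : qh_path x x 0.
Proof.
exists 0, (fun=> x), (fun=> 0); split => //; last first.
- split; rewrite ?subrr//; split=> s t s0 st t0 M _; have -> : s = t by lra.
    by rewrite !subrr mulr0.
  by rewrite !subrr mulr0.
- by move=> s t s0 st t0; rewrite mdistxx subr_ge0.
Qed.

(** On a path of duration L the boundary distance is at most D + L, where D is its value at x. Hence
    c >= L / (D + L), and L >= d(x, y). Cleared of the division, this is a linear substitute for c
    >= log(1 + d(x, y) / D), informative for c < 1. *)
Lemma qh_path_ge x y c : qh_path x y c ->
  mdist x y * (1 - c) <= c * boundary_dist x.
Proof.
move=> [L [h [G [L0 lip h0 hL [[_ lG] cE]]]]].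
have dx := delta_gt0 x; have dL : 0 < boundary_dist x + L by rewrite ltr_pwDl.
have dist_le : mdist x y <= L by rewrite -h0 -hL -[leRHS]subr0 lip.
have : (boundary_dist x + L)^-1 * (L - 0) <= c.
  rewrite cE; apply: lG => // u /andP[u0 uL]; rewrite lef_pV2 ?posrE//.
  have := lip 0 u (lexx _) u0 uL; rewrite h0 metric_sym => lip0.
  by have := delta_lip (h u) x; lra.
rewrite subr0 mulrC ler_pdivrMr// => Lc.
have c0 : 0 <= c.
  by have := le_trans L0 Lc; rewrite pmulr_lge0.
case: (leP c 1) => c1; last first.
  apply: (@le_trans _ _ 0); last by rewrite mulr_ge0// ltW.
  by rewrite mulr_ge0_le0// ?mdist_ge0//; lra.
apply: (@le_trans _ _ (L * (1 - c))); last by lra.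
by rewrite ler_wpM2r// subr_ge0.
Qed.

Lemma qh_path_ge0 x y c : qh_path x y c -> 0 <= c.
Proof.
move=> [L [h [G [L0 lip h0 hL [[_ lG] ->]]]]].
rewrite -[leLHS](mul0r (L - 0)); apply: lG => // u _.
by rewrite invr_ge0 ltW.
Qed.

Lemma qh_dist_ge0 x y : 0 <= qh_dist x y.
Proof.
apply/ler_addgt0Pr => e e0.
have [c /qh_path_ge0 c0 ce] := qh_dist_approx x y e0; lra.
Qed.

Lemma qh_dist_sym x y : qh_dist x y = qh_dist y x.
Proof.
suff h u v : qh_dist u v <= qh_dist v u by apply/le_anti; rewrite !h.
apply/ler_addgt0Pr => e e0.
have [c /qh_path_sym/qh_dist_le uvc ce] := qh_dist_approx v u e0; lra.
Qed.

Lemma qh_dist_triangle y x z : qh_dist x z <= qh_dist x y + qh_dist y z.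
Proof.
apply/ler_addgt0Pr => e e0; have e20 : 0 < e / 2 by rewrite divr_gt0.
have [c xyc ce] := qh_dist_approx x y e20.
have [c' yzc ce'] := qh_dist_approx y z e20.
by have := qh_dist_le (qh_path_trans xyc yzc); lra.
Qed.

Lemma qh_distxx x : qh_dist x x = 0.
Proof. by apply/le_anti; rewrite qh_dist_ge0 andbT; exact/qh_dist_le/qh_path_refl. Qed.

Lemma qh_dist_lower x y :
  mdist x y * (1 - qh_dist x y) <= qh_dist x y * boundary_dist x.
Proof.
set k := qh_dist x y; set d := mdist x y; have d0 : 0 <= d := mdist_ge0 _ _.
have dx := delta_gt0 x; apply/ler_addgt0Pr => e e0.
(* The inequality is affine in the cost with slope [d + boundary_dist x], which fixes the error
   allowed in the infimum. *)
have e'0 : 0 < e / (d + boundary_dist x) by rewrite divr_gt0// ltr_wpDl.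
have [c xyc ce] := qh_dist_approx x y e'0.
have H := qh_path_ge xyc.
apply: (@le_trans _ _ (c * boundary_dist x - d * (1 - c) + d * (1 - k))).
  by rewrite lerDr subr_ge0.
have -> : c * boundary_dist x - d * (1 - c) + d * (1 - k)
  = k * boundary_dist x + (c - k) * (d + boundary_dist x) by lra.
rewrite lerD2l -ler_pdivlMr ?ltr_wpDl//; rewrite -/k in ce; lra.
Qed.

Lemma qh_dist_half x y : qh_dist x y <= 2^-1 ->
  mdist x y <= 2 * qh_dist x y * boundary_dist x.
Proof.
have := qh_dist_lower x y; have := mdist_ge0 x y.
set k := qh_dist x y; set d := mdist x y => d0 H k2.
have : d * 2^-1 <= d * (1 - k) by rewrite ler_wpM2l//; lra.
lra.
Qed.

Lemma qh_dist_eq0 x y : qh_dist x y <= 0 -> x = y.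
Proof.
move=> k0; apply: mdist_eq0; have E : qh_dist x y = 0.
  by apply/le_anti; rewrite k0 qh_dist_ge0.
by have := qh_dist_lower x y; rewrite E subr0 mulr1 mul0r.
Qed.

(** Some curve from x to y is shorter than 2 d(x, y), hence than half the boundary distance D of x.
    Along it the boundary distance is at least D / 2, so the cost is at most (2 / D) (2 d(x, y)). *)
Lemma qh_dist_upper x y : length_space X -> mdist x y < boundary_dist x / 4 ->
  qh_dist x y <= 4 * mdist x y / boundary_dist x.
Proof.
move=> lsX; have := mdist_ge0 x y; rewrite le_eqVlt => /predU1P[d0 _|d0 xy].
  rewrite -d0 mulr0 mul0r; have -> : x = y by apply: mdist_eq0; rewrite -d0.
  by rewrite qh_distxx.
have fn : intrinsic_dist x y \is a fin_num by rewrite -lsX.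
have [_ [g [rg [gx gy]] <-]] := lb_ereal_inf_adherent d0 fn.
rewrite -/(intrinsic_dist x y) -lsX -total_lengthE// -EFinD lte_fin => L2.
set L := total_length g in L2 *; have L0 : 0 <= L by exact: total_length_ge0.
have [G [uG lG] _] := line_integral_primitive rg; rewrite -/L in uG lG.
have lip := one_lipschitz_arclength_param rg; rewrite -/L in lip.
have dx := delta_gt0 x.
have : G L - G 0 <= (boundary_dist x / 2)^-1 * (L - 0).
  apply: uG => // u /andP[u0 uL]; rewrite lef_pV2 ?posrE ?divr_gt0//.
  have := lip 0 u (lexx _) u0 uL; rewrite arclength_param0// gx => xu.
  by have := delta_lip x (arclength_param g u); lra.
rewrite subr0 invf_div => H.
have : qh_dist x y <= G L - G 0.
  apply: qh_dist_le; exists L, (arclength_param g), G; split => //.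
  - by rewrite arclength_param0.
  - by rewrite arclength_paramL.
move=> /le_trans; apply; apply: (le_trans H).
rewrite mulrAC ler_wpM2r ?invr_ge0 ?(ltW dx)//; lra.
Qed.

End quasihyperbolic.

(** * Existence of quasihyperbolic geodesics *)

Lemma ultra_fmap (T S : Type) (f : T -> S) (U : set_system T) :
  UltraFilter U -> UltraFilter (f @ U).
Proof.
move=> UU; split; first exact: fmap_proper_filter.
move=> G PG UG; apply/seteqP; split=> A; last exact: UG.
move=> GA; have [//|UnA] := in_ultra_setVsetC (f @^-1` A) UU.
have /filter_ex[x []] // : G (A `&` ~` A) by apply: filterI => //; exact: UG.
Qed.

Section geodesics.
Context {R : realType} {X : metricType R}.
Context (lcX : locally_compact [set: X]) (incX : ~ metric_complete X).
Context (rcX : rectifiably_connected X) (lsX : length_space X).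
Implicit Types x y p q : X.

Let delta_gt0 x : 0 < boundary_dist x := boundary_dist_gt0 x lcX incX.

(** Together with [mdist_near]: k and d induce the same topology, so local compactness passes to k
    and k-limits pass back to d. *)
Lemma qh_dist_near p (e : R) : 0 < e ->
  exists2 d : R, 0 < d & forall q, mdist p q < d -> qh_dist p q < e.
Proof.
move=> e0; have dp := delta_gt0 p.
exists (Num.min (boundary_dist p / 4) (e * boundary_dist p / 4)).
  by rewrite lt_min !divr_gt0 ?mulr_gt0.
move=> q; rewrite lt_min => /andP[pq1 pq2].
apply: le_lt_trans (qh_dist_upper lcX incX rcX lsX pq1) _.
by rewrite ltr_pdivrMr//; lra.
Qed.

Lemma mdist_near p (e : R) : 0 < e ->
  exists2 d : R, 0 < d & forall q, qh_dist p q < d -> mdist p q < e.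
Proof.
move=> e0; have dp := delta_gt0 p.
exists (Num.min 2^-1 (e / (2 * boundary_dist p))).
  by rewrite lt_min invr_gt0 ltr0n divr_gt0 ?mulr_gt0.
move=> q; rewrite lt_min => /andP[pq1 pq2].
apply: le_lt_trans (qh_dist_half lcX incX rcX (ltW pq1)) _.
by move: pq2; rewrite ltr_pdivlMr ?mulr_gt0//; lra.
Qed.

(* Along a sequence that is Cauchy for the quasihyperbolic distance, the
   distance to the boundary stays bounded below, so the sequence is Cauchy for
   the original distance and its limit in the completion is not a boundary point. *)
Lemma qh_complete (p : nat -> X) :
  (forall e : R, 0 < e -> exists N, forall m n, (N <= m)%N -> (N <= n)%N ->
    qh_dist (p m) (p n) < e) ->
  exists l, forall e : R, 0 < e -> exists N, forall n, (N <= n)%N -> qh_dist l (p n) < e.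
Proof.
move=> cp; have q40 : 0 < 4^-1 :> R by rewrite invr_gt0.
(* Within quasihyperbolic distance 1/4 of [p J], the distance d is at most half the boundary
   distance D of [p J]; the boundary distance then stays between D / 2 and 2 D. *)
have [J HJ] := cp _ q40; have dJ := delta_gt0 (p J).
set D := boundary_dist (p J) in dJ.
have near n : (J <= n)%N -> boundary_dist (p n) <= 2 * D /\ D <= 2 * boundary_dist (p n).
  move=> Jn; have k4 := HJ _ _ (leqnn J) Jn.
  have k0 := qh_dist_ge0 lcX incX rcX (p J) (p n).
  have kd : mdist (p J) (p n) <= 2^-1 * D.
    apply: le_trans (qh_dist_half lcX incX rcX _) _; first by lra.
    by rewrite ler_wpM2r ?(ltW dJ)//; lra.
  have := boundary_dist_lip (p J) (p n) incX.
  have := boundary_dist_lip (p n) (p J) incX.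
  by rewrite -/D (metric_sym (p n)); lra.
have cpd : cauchy (p @ \oo).
  apply/cauchy_mdistP => e e0.
  have e'0 : 0 < Num.min 2^-1 (e / (4 * D)) by rewrite lt_min invr_gt0 ltr0n divr_gt0 ?mulr_gt0.
  have [N HN] := cp _ e'0; exists (maxn N J) => m n.
  rewrite !geq_max => /andP[Nm Jm] /andP[Nn Jn].
  have := HN m n Nm Nn; rewrite lt_min => /andP[k2 ke].
  apply: le_lt_trans (qh_dist_half lcX incX rcX (ltW k2)) _.
  have [dm _] := near m Jm; have k0 := qh_dist_ge0 lcX incX rcX (p m) (p n).
  apply: (@le_lt_trans _ _ (2 * qh_dist (p m) (p n) * (2 * D))).
    by rewrite ler_wpM2l// mulr_ge0.
  by move: ke; rewrite ltr_pdivlMr ?mulr_gt0//; lra.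
have cpd' : cauchy_sequence p by exact/asboolP.
pose u : cauchy_seq_of X := exist _ p cpd'.
have [[l _ lE]|nl] := pselect (range embed (\pi_(completion X) u)); last first.
  exfalso.
  have /cvgrPdist_lt := @cauchy_cvg_completion _ _ u.
  move=> /(_ (D / 2)); rewrite divr_gt0// => /(_ isT)[N _ HN].
  have := HN (maxn N J) (leq_maxl _ _); rewrite /= metric_sym.
  move=> /(le_lt_trans (boundary_dist_le (p (maxn N J)) nl)).
  by have [_] := near (maxn N J) (leq_maxr _ _); clear -dJ; lra.
have pl := embed_cvg (esym lE); exists l => e e0.
have [d d0 dP] := qh_dist_near l e0.
by have /cvgrPdist_lt/(_ _ d0)[N _ NP] := pl; exists N => n Nn; apply: dP; exact: NP.
Qed.

(** A path of cost c < K + e is reparametrized by the cost spent so far and stopped at K. The cost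
    of a subpath bounds k between its ends, which gives the Lipschitz bound, and the remaining cost
    c - K bounds the distance to y. *)
Lemma near_geodesic x y (e : R) : 0 < e -> exists f : R -> X,
  [/\ f 0 = x, qh_dist (f (qh_dist x y)) y <= e &
   forall s t, 0 <= s <= qh_dist x y -> 0 <= t <= qh_dist x y ->
     qh_dist (f s) (f t) <= `|s - t|].
Proof.
move=> e0; set K := qh_dist x y.
have [c xyc ce] := qh_dist_approx lcX incX rcX x y e0.
rewrite -/K in ce; have Kc : K <= c := qh_dist_le lcX incX rcX xyc.
case: xyc => L [h [G [L0 lip h0 hL [pG cE]]]].
have cF := qh_density_continuous lcX incX lip.
have [m _ Fm] := @EVT_max _ (qh_density h) 0 L L0 cF.
set M := qh_density h m in Fm.
have M0 : 0 <= M by rewrite /M /qh_density invr_ge0 ltW.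
have Gle s t : 0 <= s -> s <= t -> t <= L -> 0 <= G t - G s <= M * (t - s).
  move=> s0 st tL; apply/andP; split.
    rewrite -[leLHS](mul0r (t - s)); apply: pG.2 => // u _.
    by rewrite invr_ge0 ltW.
  by apply: pG.1 => // u /andP[su ut]; apply: Fm; rewrite in_itv /=; lra.
have cG : {within `[0, L], continuous G}.
  apply: (@lipschitz_within _ R^o _ _ _ M) => // s t /andP[s0 sL] /andP[t0 tL].
  rewrite /mdist /=; case: (leP s t) => [|/ltW] st.
    have := Gle s t s0 st tL => /andP[G0 GM].
    by rewrite ger0_norm// distrC ger0_norm// subr_ge0.
  have := Gle t s t0 st sL => /andP[G0 GM].
  by rewrite distrC ger0_norm// ger0_norm// subr_ge0.
have inv t : exists s, 0 <= t <= c -> 0 <= s <= L /\ G s - G 0 = t.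
  have [/andP[t0 tc]|] := boolP (0 <= t <= c); last by exists 0.
  have [|s] := @IVT _ G 0 L (t + G 0) L0 cG.
    have := Gle 0 L (lexx _) L0 (lexx _) => /andP[G0 _].
    by rewrite ge_min le_max; apply/andP; split; apply/orP; [left|right]; lra.
  by rewrite in_itv /= => sL Gs; exists s => _; split=> //; lra.
have [S HS] := choice inv; have c0 : 0 <= c.
  by apply: le_trans Kc; exact: qh_dist_ge0.
have K0 : 0 <= K by exact: qh_dist_ge0.
have S_le s t : 0 <= s -> s <= t -> t <= c -> qh_dist (h (S s)) (h (S t)) <= t - s.
  move=> s0 st tc.
  have [/andP[Ss0 SsL] Gs] := HS s ltac:(lra).
  have [/andP[St0 StL] Gt] := HS t ltac:(lra).
  have [Sst|/ltW Sts] := leP (S s) (S t).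
    have := qh_dist_le lcX incX rcX (qh_path_sub lip pG Ss0 Sst StL); lra.
  have := qh_dist_le lcX incX rcX (qh_path_sub lip pG St0 Sts SsL).
  rewrite qh_dist_sym// ; lra.
(* [S 0] need not be 0, but a stretch of zero cost does not leave x. *)
have hx u : 0 <= u <= L -> G u - G 0 = 0 -> h u = x.
  move=> /andP[u0 uL] Gu; apply/esym/(qh_dist_eq0 lcX incX rcX).
  have := qh_dist_le lcX incX rcX (qh_path_sub lip pG (lexx _) u0 uL).
  by rewrite h0 Gu.
exists (h \o S); split.
- by have [? ?] := HS 0 ltac:(lra); rewrite /= hx.
- have [/andP[SK0 SKL] GK] := HS K ltac:(lra).
  have := qh_dist_le lcX incX rcX (qh_path_sub lip pG SK0 SKL (lexx _)).
  rewrite hL /=; lra.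
- move=> s t /andP[s0 sK] /andP[t0 tK] /=; have [st|/ltW ts] := leP s t.
    by rewrite distrC ger0_norm ?subr_ge0// S_le//; lra.
  by rewrite ger0_norm ?subr_ge0// qh_dist_sym// S_le//; lra.
Qed.

(* The set of times at which the nearly optimal paths converge along the
   ultrafilter is closed by completeness and open by local compactness. *)
Lemma exists_quasihyperbolic_geodesic x y :
  exists2 g : @curve R X, quasihyperbolic_geodesic g & joins g x y.
Proof.
set K := qh_dist x y; have K0 : 0 <= K by exact: qh_dist_ge0.
have kge0 := qh_dist_ge0 lcX incX rcX; have ksym := qh_dist_sym lcX incX rcX.
have ktri := qh_dist_triangle lcX incX rcX; have kxx := qh_distxx lcX incX rcX.
have /choice[f fP] (n : nat) := near_geodesic x y (e := n.+1%:R^-1) ltac:(by rewrite invr_gt0).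
have [U [UU Uoo]] := @ultraFilterLemma nat (\oo) _.
pose lim_at t p := forall e : R, 0 < e -> U [set n | qh_dist p (f n t) < e].
have lim_dist s t p q : 0 <= s <= K -> 0 <= t <= K -> lim_at s p -> lim_at t q ->
    qh_dist p q <= `|s - t|.
  move=> sK tK ps qt; apply/ler_addgt0Pr => e e0.
  have e20 : 0 < e / 2 by rewrite divr_gt0.
  have [n [/= pn qn]] := @filter_ex _ _ _ _ (filterI (ps _ e20) (qt _ e20)).
  have [_ _ /(_ s t sK tK) fst_] := fP n.
  have := ktri (f n s) p q; have := ktri (f n t) (f n s) q; rewrite (ksym (f n t) q); lra.
have conv t : 0 <= t <= K -> exists p, lim_at t p.
  move: t; apply: real_induction => //.
    move=> t /andP[t0 tK] ht.
    move: t0; rewrite le_eqVlt => /predU1P[<-|t0].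
      exists x => e e0; apply: filterS (@filterT _ U _) => n _ /=.
      by have [-> _ _] := fP n; rewrite kxx.
    pose s (j : nat) := t - t * j.+1%:R^-1.
    have sP j : 0 <= s j < t.
      have j0 : 0 < j.+1%:R^-1 :> R by rewrite invr_gt0.
      have j1 : j.+1%:R^-1 <= 1 :> R by rewrite invf_le1// ler1n.
      by rewrite /s subr_ge0 ler_piMr ?(ltW t0)//= ltrBlDr ltrDl mulr_gt0.
    have /choice[p pP] j := ht (s j) (sP j).
    have s_cvg (e : R) : 0 < e -> exists N, forall n, (N <= n)%N -> t - s n < e.
      move=> e0; have e'0 : 0 < e / t by rewrite divr_gt0.
      have [N _ NP] := near_infty_natSinv_lt (PosNum e'0); exists N => n Nn.
      rewrite /s opprB addrC subrK mulrC -ltr_pdivlMr//; exact: NP.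
    have sK j : 0 <= s j <= K by have := sP j; lra.
    have [l lP] : exists l, forall e : R, 0 < e ->
        exists N, forall n, (N <= n)%N -> qh_dist l (p n) < e.
      apply: qh_complete => e e0; have [N NP] := s_cvg e e0; exists N => m n Nm Nn.
      apply: le_lt_trans (lim_dist _ _ _ _ (sK m) (sK n) (pP m) (pP n)) _.
      have := NP m Nm; have := NP n Nn; have := sP m; have := sP n.
      by rewrite ltr_norml; lra.
    exists l => e e0; have e30 : 0 < e / 3 by rewrite divr_gt0.
    have [N1 N1P] := lP _ e30; have [N2 N2P] := s_cvg _ e30.
    pose j := maxn N1 N2; have lj := N1P j (leq_maxl _ _).
    have sj := N2P j (leq_maxr _ _).
    apply: filterS (pP j _ e30) => n /= pn.
    have tK' : 0 <= t <= K by lra.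
    have [_ _ /(_ (s j) t (sK j) tK')] := fP n.
    rewrite ler0_norm; last by have := sP j; lra.
    have := ktri (p j) l (f n t); have := ktri (f n (s j)) (p j) (f n t); lra.
  move=> t /andP[t0 tK] ht; have [p pt] := ht t ltac:(lra).
  have [d [C [d0 cC dC]]] := compact_nbhs_ball p lcX.
  have [e e0 ed] := mdist_near p d0; have e20 : 0 < e / 2 by rewrite divr_gt0.
  exists (e / 2) => // s /andP[ts ste] sK.
  have UC : U [set n | C (f n s)].
    apply: filterS (pt _ e20) => n /= pn; apply: dC; rewrite ballEmdist /=; apply: ed.
    have tK' : 0 <= t <= K by lra.
    have sK' : 0 <= s <= K by lra.
    have [_ _ /(_ t s tK' sK')] := fP n.
    rewrite distrC ger0_norm ?subr_ge0 ?(ltW ts)// => ts_.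
    by have := ktri (f n t) p (f n s); lra.
  move: cC; rewrite compact_ultra => /(_ _ (ultra_fmap (fun n => f n s) UU) UC)[q [Cq Uq]].
  exists q => e' e'0; have [d' d'0 d'P] := qh_dist_near q e'0.
  have /cvgrPdist_lt/(_ _ d'0) := Uq.
  by apply: filterS => n; exact: d'P.
have /choice[g gP] t : exists p, 0 <= t <= K -> lim_at t p.
  have [/conv[p pt]|] := boolP (0 <= t <= K); first by exists p.
  by exists x.
have gx : g 0 = x.
  apply: (qh_dist_eq0 lcX incX rcX); rewrite -[leRHS](normr0 R) -[X in `|X|](subrr 0).
  apply: lim_dist (gP _ _) _; rewrite ?lexx// => e e0.
  by apply: filterS (@filterT _ U _) => n _ /=; have [-> _ _] := fP n; rewrite kxx.
have gy : g K = y.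
  apply: (qh_dist_eq0 lcX incX rcX); rewrite -[leRHS](normr0 R) -[X in `|X|](subrr K).
  apply: lim_dist (gP _ _) _; rewrite ?lexx ?K0// => e e0.
  have [N _ NP] := near_infty_natSinv_lt (PosNum e0).
  apply: Uoo; exists N => // n /= Nn; rewrite ksym.
  by have [_ fK _] := fP n; apply: le_lt_trans fK _; exact: NP.
have glip s t : 0 <= s <= K -> 0 <= t <= K -> qh_dist (g s) (g t) <= `|s - t|.
  by move=> sK tK; apply: lim_dist => //; exact: gP.
have geq s t : 0 <= s <= K -> 0 <= t <= K -> qh_dist (g s) (g t) = `|s - t|.
  wlog st : s t / s <= t.
    move=> H sK tK; have [st|/ltW ts] := leP s t; first exact: H.
    by rewrite ksym distrC H.
  (* The upper bounds on [0, s], [s, t] and [t, K] add up to K = k(x, y), so by the triangle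
     inequality none of them is strict. *)
  move=> sK tK; apply/le_anti; rewrite glip//=.
  rewrite distrC ger0_norm ?subr_ge0//.
  have := glip 0 s ltac:(lra) sK; rewrite gx distrC ger0_norm; last by lra.
  have := glip t K tK ltac:(lra); rewrite gy distrC ger0_norm; last by lra.
  by have := ktri (g s) x y; have := ktri (g t) (g s) y; rewrite -/K; lra.
have cg : {within `[0, K], continuous g}.
  apply/within_itv_mdistP => t tK e e0; have [d d0 dP] := mdist_near (g t) e0.
  by exists d => // s sK ts; apply: dP; rewrite geq.
exists (Curve K0 cg); last by [].
move=> s t; rewrite !in_itv /= => sK tK.
by rewrite (qh_distE lcX incX rcX) geq.
Qed.

End geodesics.

(** * Quasihyperbolic geodesics in uniform spaces: one-variable estimates *)

Section cone_profile.
Context {R : realType}.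

(* Abstracts a quasihyperbolic geodesic parametrized by its quasihyperbolic
   length: [delta] is the distance to the boundary, [len] the length of
   subarcs and [ds] the distance between points. The last field encodes the
   sublinear upper bound on the quasihyperbolic distance in a uniform space:
   taking [N] large makes the coefficient of [ds s t / m] small. *)
Record cone_profile (A a b : R) (delta : R -> R) (len ds : R -> R -> R) : Prop :=
  ConeProfile {
  profile_le : a <= b;
  profile_gt0 : forall t, a <= t <= b -> 0 < delta t;
  profile_continuous : forall t, a <= t <= b -> forall e, 0 < e ->
    exists2 d, 0 < d &
      forall s, a <= s <= b -> `|t - s| < d -> `|delta t - delta s| < e;
  profile_double : forall s t, a <= s <= b -> a <= t <= b ->
    `|s - t| <= 4^-1 -> delta t <= 2 * delta s;
  profile_len_ge0 : forall s t, a <= s -> s <= t -> t <= b -> 0 <= len s t;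
  profile_lenD : forall s t u, a <= s -> s <= t -> t <= u -> u <= b ->
    len s u = len s t + len t u;
  profile_len_le : forall s t M, a <= s -> s <= t -> t <= b ->
    (forall u, s <= u <= t -> delta u <= M) -> len s t <= 2 * M * (t - s);
  profile_ds_ge0 : forall s t, 0 <= ds s t;
  profile_ds_len : forall s t, a <= s -> s <= t -> t <= b -> ds s t <= len s t;
  profile_ds_triangle : forall s t, a <= s -> s <= t -> t <= b ->
    ds s t <= ds a b + len a s + len t b;
  profile_gap : forall s t m N, a <= s -> s <= t -> t <= b -> 0 < m ->
    m <= delta s -> m <= delta t -> 0 <= N ->
    t - s <= A * (2 * N + (ds s t / m) / (1 + N))
}.

(** Carries estimates proved to the left of the maximum of delta over to its right. *)
Lemma cone_profile_reverse A a b delta len ds : cone_profile A a b delta len ds ->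
  cone_profile A (- b) (- a) (fun t => delta (- t)) (fun s t => len (- t) (- s))
    (fun s t => ds (- t) (- s)).
Proof.
move=> p; have neg t : - b <= t <= - a -> a <= - t <= b by move=> ?; lra.
split.
- by have := profile_le p; lra.
- by move=> t /neg; exact: (profile_gt0 p).
- move=> t /neg tab e e0; have [d d0 dP] := profile_continuous p tab e0.
  exists d => // s /neg sab ts; apply: dP => //.
  by rewrite opprK addrC distrC.
- move=> s t /neg sab /neg tab st; apply: (profile_double p sab tab).
  by rewrite opprK addrC distrC.
- by move=> s t bs st ta; apply: (profile_len_ge0 p); lra.
- move=> s t u bs st tu ua; rewrite addrC.
  by apply: (profile_lenD p); lra.
- move=> s t M bs st ta h.
  have -> : 2 * M * (t - s) = 2 * M * (- s - - t) by lra.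
  apply: (profile_len_le p); [lra..|] => u hu.
  by rewrite -[u]opprK; apply: h; lra.
- by move=> s t; exact: (profile_ds_ge0 p).
- by move=> s t bs st ta; apply: (profile_ds_len p); lra.
- move=> s t bs st ta; rewrite !opprK.
  by have := @profile_ds_triangle _ _ _ _ _ _ p (- t) (- s) ltac:(lra) ltac:(lra) ltac:(lra); lra.
- move=> s t m N bs st ta m0 ms mt N0.
  have -> : t - s = - s - - t by lra.
  by apply: (profile_gap p) => //; lra.
Qed.

(** Time x is crossed in at most [Num.bound (4 * x)] steps of 1/4, each at most doubling delta. *)
Definition doubling_const (x : R) : R := 2 ^+ Num.bound (4 * x).

Lemma doubling_const_ge1 x : 1 <= doubling_const x.
Proof. by rewrite /doubling_const exprn_ege1// ler1n. Qed.

(** Q bounds the failure of delta to increase before its maximum, and D = 32 A^2 Q + 1 exceeds the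
    time after which delta has doubled. A stretch of duration D ending at t has length at most 2 Q D
    delta(t), half of [cone_const A * delta t]; what precedes it contributes the other half. *)
Definition cone_const (A : R) : R :=
  let Q := doubling_const (32 * A ^+ 2) in 4 * (32 * A ^+ 2 * Q + 1) * Q.

(** The 2 pays for two end pieces of length d(x, y) each, the product for the piece between them;
    see [profile_quasiconvex]. *)
Definition quasiconvex_const (A : R) : R :=
  2 + 6 * A * doubling_const (3 * A * cone_const A).

Lemma cone_const_ge0 A : 0 <= cone_const A.
Proof.
have Q1 := doubling_const_ge1 (32 * A ^+ 2).
have Q0 := le_trans ler01 Q1.
have T0 : 0 <= 32 * A ^+ 2 by rewrite mulr_ge0// sqr_ge0.
by rewrite /cone_const mulr_ge0// mulr_ge0// addr_ge0// mulr_ge0.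
Qed.

(** * Quasi-monotonicity, halving and the cone estimate for a profile *)

Section profile.
Context (A a b : R) (delta : R -> R) (len ds : R -> R -> R).
Context (A1 : 1 <= A) (p : cone_profile A a b delta len ds).

Lemma profile_doubling x s t : a <= s <= b -> a <= t <= b -> 0 <= x ->
  `|s - t| <= x -> delta t <= doubling_const x * delta s.
Proof.
move=> sab tab x0 st.
have {x0 st} : `|s - t| <= (Num.bound (4 * x))%:R / 4.
  apply: (le_trans st); rewrite ler_pdivlMr// mulrC ltW//.
  by apply: archi_boundP; rewrite mulr_ge0.
rewrite /doubling_const; elim: (Num.bound _) s sab => [|n IH] s sab st.
  have -> : t = s by move: st; rewrite mul0r normr_le0 subr_eq0 => /eqP.
  by rewrite expr0 mul1r.
have ds_gt0 : 0 < delta s by exact: (profile_gt0 p).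
have nn : 0 <= n%:R :> R by exact: ler0n.
have [st4|st4] := leP `|s - t| 4^-1.
  apply: le_trans (profile_double p sab tab st4) _.
  by rewrite exprS ler_wpM2r ?(ltW ds_gt0)// ler_peMr// exprn_ege1// ler1n.
pose u := if s <= t then s + 4^-1 else s - 4^-1.
have [uab su ut] : [/\ a <= u <= b, `|s - u| <= 4^-1 & `|u - t| <= n%:R / 4].
  move: st st4; rewrite -natr1 /u; case: (leP s t) => H.
    rewrite distrC ger0_norm ?subr_ge0// => h1 h2; split; first by lra.
      by rewrite opprD addNKr normrN ger0_norm.
    by rewrite distrC ger0_norm; lra.
  rewrite gtr0_norm ?subr_gt0// => h1 h2; split; first by lra.
    by rewrite opprB addrC subrK ger0_norm.
  by rewrite ger0_norm; lra.
apply: (le_trans (IH u uab ut)); rewrite exprSr -mulrA ler_wpM2l ?exprn_ge0//.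
exact: (profile_double p sab uab su).
Qed.

(** Since ds is at most 2 M (t - s), the choice N = 4 A / l bounds the distance term of
    [profile_gap] by (t - s) / 2. Absorbing it leaves t - s <= 4 A N. *)
Lemma profile_gap_le s t M l : a <= s -> s <= t -> t <= b -> 0 < M -> 0 < l ->
  (forall u, s <= u <= t -> delta u <= M) -> l * M <= delta s -> l * M <= delta t ->
  t - s <= 16 * A ^+ 2 / l.
Proof.
move=> as_ st tb M0 l0 hM ls lt.
have A0 : 0 < A := lt_le_trans ltr01 A1.
pose N := 4 * A / l; have N0 : 0 < N by rewrite divr_gt0// mulr_gt0.
have lM0 : 0 < l * M by rewrite mulr_gt0.
have H := profile_gap p as_ st tb lM0 ls lt (ltW N0).
have L : ds s t / (l * M) <= 2 / l * (t - s).
  rewrite ler_pdivrMr//; apply: le_trans (profile_ds_len p as_ st tb) _.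
  apply: (le_trans (profile_len_le p as_ st tb hM)).
  have -> // : 2 / l * (t - s) * (l * M) = 2 * M * (t - s).
  by field; rewrite gt_eqF.
have E : A * ((ds s t / (l * M)) / (1 + N)) <= (t - s) / 2.
  apply: (@le_trans _ _ (A * ((2 / l * (t - s)) / N))).
    rewrite ler_wpM2l ?(ltW A0)//; apply: ler_pM.
    - by rewrite divr_ge0 ?(ltW lM0)// (profile_ds_ge0 p).
    - by rewrite invr_ge0; lra.
    - exact: L.
    - by rewrite lef_pV2 ?posrE; lra.
  have -> // : A * ((2 / l * (t - s)) / N) = (t - s) / 2.
  by rewrite /N; field; rewrite !gt_eqF.
have -> : 16 * A ^+ 2 / l = 4 * A * N by rewrite /N expr2; field; rewrite gt_eqF.
by move: H; rewrite mulrDr; lra.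
Qed.

Context (t0 : R) (t0ab : a <= t0 <= b).
Context (t0max : forall t, a <= t <= b -> delta t <= delta t0).

Local Notation Q := (doubling_const (32 * A ^+ 2)).

Lemma profile_continuous_itv s t : a <= s -> t <= b -> {within `[s, t], continuous delta}.
Proof.
move=> as_ tb; apply/(@within_itv_mdistP R R^o) => u ust e e0.
have [d d0 dP] := profile_continuous p (t := u) ltac:(lra) e0.
by exists d => // v vst uv; rewrite /mdist /= distrC; apply: dP => //; lra.
Qed.

(* If [delta s'] is the maximum over [s, t] and v > t is the first time at which
   that value is reached again, then [profile_gap_le] bounds v - s'. *)
Lemma profile_increasing s t : a <= s -> s <= t -> t <= t0 -> delta s <= Q * delta t.
Proof.
have t0I := t0ab; move=> as_ st tt0; have tb : t <= b by lra.
have [s' s'I s'max] := EVT_max st (profile_continuous_itv as_ tb).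
rewrite in_itv /= in s'I; set m := delta s' in s'max.
have m0 : 0 < m by apply: (profile_gt0 p); lra.
have sm : delta s <= m by apply: s'max; rewrite in_itv /= lexx.
have T0 : 0 <= 32 * A ^+ 2 by rewrite mulr_ge0// sqr_ge0.
apply: (le_trans sm); apply: profile_doubling => //; try lra.
rewrite ger0_norm; last by lra.
rewrite leNgt; apply/negP => far.
(* If s' lies too far before t, delta never climbs back to m before t0, contradicting the maximality
   of [delta t0]. *)
suff : delta t0 < m by rewrite ltNge t0max//; lra.
suff H : forall v, t <= v <= t0 -> delta v < m by apply: H; rewrite tt0 lexx.
apply: real_induction => //.
  move=> v /andP[tv vt0] h; rewrite ltNge; apply/negP => mv.
  (* Before v, delta is at most m on [s', v), and one doubling step bounds [delta v] by 2 m. Then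
     [profile_gap_le] with M = 2 m and l = 1/2 gives v - s' <= 32 A^2, the origin of that constant,
     against [far]. *)
  have v2 : delta v <= 2 * m.
    move: tv; rewrite le_eqVlt => /predU1P[<-|tv].
      have : delta t <= m by apply: s'max; rewrite in_itv /= lexx st.
      lra.
    pose v' := Num.max t (v - 4^-1).
    have [v'1 v'2 v'3] : [/\ t <= v', v' < v & v - 4^-1 <= v'].
      by rewrite /v' !le_max !lexx orbT gt_max tv; split => //; lra.
    have := @profile_double _ _ _ _ _ _ p v' v ltac:(lra) ltac:(lra).
    rewrite distrC ger0_norm ?subr_ge0 ?(ltW v'2)// => /(_ ltac:(lra)).
    have := h v' ltac:(lra); lra.
  have := @profile_gap_le s' v (2 * m) 2^-1 ltac:(lra) ltac:(lra) ltac:(lra) ltac:(lra) ltac:(lra).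
  have -> : 2^-1 * (2 * m) = m by field.
  move=> /(_ _ (lexx _) mv) H; have {H} : v - s' <= 16 * A ^+ 2 / 2^-1.
    apply: H => u /andP[s'u uv]; have [ut|tu] := leP u t.
      have : delta u <= m by apply: s'max; rewrite in_itv /= ut andbT; lra.
      lra.
    move: uv; rewrite le_eqVlt => /predU1P[->//|uv].
    have := h u ltac:(lra); lra.
  rewrite invrK; lra.
move=> v /andP[tv vt0] h; have vm := h v ltac:(lra).
have [d d0 dP] := @profile_continuous _ _ _ _ _ _ p v ltac:(lra) (m - delta v) ltac:(lra).
exists d => // u /andP[vu uvd] ut0.
have : `|v - u| < d by rewrite distrC ger0_norm; lra.
move=> /(dP u ltac:(lra)); rewrite ltr_norml; lra.
Qed.

(** On [r, t] delta is at most Q delta(t) by quasi-monotonicity. If both ends were at least delta(t)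
    / 2, [profile_gap_le] with l = 1 / (2 Q) would bound t - r by 32 A^2 Q. *)
Lemma profile_halving r t : a <= r -> t <= t0 ->
  32 * A ^+ 2 * Q < t - r -> delta r <= delta t / 2.
Proof.
have t0I := t0ab; move=> ar tt0 far; have Q1 := doubling_const_ge1 (32 * A ^+ 2).
have rt : r <= t.
  have T0 : 0 <= 32 * A ^+ 2 by rewrite mulr_ge0// sqr_ge0.
  by have : 0 <= 32 * A ^+ 2 * Q; [rewrite mulr_ge0//|]; lra.
have dt : 0 < delta t by apply: (profile_gt0 p); lra.
rewrite leNgt; apply/negP => rt2.
have Q0 : 0 < Q by lra.
have := @profile_gap_le r t (Q * delta t) (2 * Q)^-1 ar rt ltac:(lra).
rewrite invrK mulr_gt0// invr_gt0 mulr_gt0// => /(_ isT isT).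
have -> : (2 * Q)^-1 * (Q * delta t) = delta t / 2 by field; rewrite gt_eqF.
have -> : 16 * A ^+ 2 * (2 * Q) = 32 * A ^+ 2 * Q by lra.
move=> H; have {H} : t - r <= 32 * A ^+ 2 * Q; last by lra.
apply: H; [|lra|lra] => u /andP[ru ut].
by apply: profile_increasing; lra.
Qed.

Lemma profile_cone t : a <= t -> t <= t0 -> len a t <= cone_const A * delta t.
Proof.
have t0I := t0ab; move=> at_ tt0; have Q1 := doubling_const_ge1 (32 * A ^+ 2).
set B := cone_const A; pose D := 32 * A ^+ 2 * Q + 1.
have BE : B = 4 * D * Q by [].
have T0 : 0 <= 32 * A ^+ 2 by rewrite mulr_ge0// sqr_ge0.
have D1 : 1 <= D by rewrite lerDr mulr_ge0//; lra.
have lenD u v : a <= u -> u <= v -> v <= t0 -> v - u <= D ->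
    len u v <= B / 2 * delta v.
  move=> au uv vt0 vuD; have dv : 0 < delta v by apply: (profile_gt0 p); lra.
  have := @profile_len_le _ _ _ _ _ _ p u v (Q * delta v) au uv ltac:(lra).
  move=> /(_ _)/le_trans; apply.
    by move=> w /andP[uw wv]; apply: profile_increasing; lra.
  have -> : B / 2 * delta v = 2 * (Q * delta v) * D by rewrite BE; field.
  by rewrite ler_wpM2l// mulr_ge0// mulr_ge0//; lra.
have B0 : 0 <= B := cone_const_ge0 A.
(* Induction on the number of steps back from t: each has duration D >= 1, so it lowers n. *)
have [n] : exists n : nat, t - a <= n%:R.
  by exists (Num.bound (t - a)); rewrite ltW// archi_boundP// subr_ge0.
elim: n t at_ tt0 => [|n IH] t at_ tt0 tn;
  have dt : 0 < delta t by [apply: (profile_gt0 p); lra];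
  have Bdt : B / 2 * delta t <= B * delta t by [rewrite ler_wpM2r ?(ltW dt)//; lra].
  by apply: le_trans Bdt; apply: lenD => //; lra.
have [tD|tD] := leP (t - a) D; first by apply: le_trans Bdt; exact: lenD.
have := IH (t - D) ltac:(lra) ltac:(lra) ltac:(rewrite -natr1 in tn; lra).
have := lenD (t - D) t ltac:(lra) ltac:(lra) tt0 ltac:(lra).
have := @profile_lenD _ _ _ _ _ _ p a (t - D) t (lexx _) ltac:(lra) ltac:(lra) ltac:(lra).
have h := @profile_halving (t - D) t ltac:(lra) tt0 ltac:(rewrite /D; lra).
have : B * delta (t - D) <= B * (delta t / 2) by rewrite ler_wpM2l.
lra.
Qed.

End profile.

Lemma profile_cones A a b delta len ds : 1 <= A ->
  cone_profile A a b delta len ds ->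
  exists2 t0, a <= t0 <= b & forall t, a <= t <= b ->
    (t <= t0 -> len a t <= cone_const A * delta t) /\
    (t0 <= t -> len t b <= cone_const A * delta t).
Proof.
move=> A1 p; have ab := profile_le p.
have [t0 t0I t0max] := EVT_max ab (profile_continuous_itv p (lexx a) (lexx b)).
rewrite in_itv /= in t0I; exists t0 => // t /andP[at_ tb].
split=> tt0.
  by apply: (profile_cone A1 p t0I _ at_ tt0) => u uab; exact: t0max.
have t0I' : - b <= - t0 <= - a by lra.
have := profile_cone A1 (cone_profile_reverse p) t0I' _ (t := - t).
rewrite !opprK; apply; [|lra..].
by move=> u uab; apply: t0max; rewrite in_itv /=; lra.
Qed.

(** With r = ds a b, cut off a piece of length r at each end. The cone estimate gives delta >= r / B
    at both cuts, whose distance is at most 3 r, so the case N = 0 of [profile_gap] bounds the time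
    between them by 3 A B. On that stretch delta is comparable with its smaller value m at the cuts,
    so the length is at most 2 Q2 m times the time bound 3 A r / m. *)
Lemma profile_quasiconvex A a b delta len ds : 1 <= A ->
  cone_profile A a b delta len ds -> len a b <= quasiconvex_const A * ds a b.
Proof.
move=> A1 p; have ab := profile_le p; have A0 : 0 < A by lra.
rewrite /quasiconvex_const; have [t0 t0I] := profile_cones A1 p.
move: (cone_const_ge0 A); move: (cone_const A) => B B0 cone.
have dbl s t := profile_doubling p (x := 3 * A * B) (s := s) (t := t).
move: (doubling_const_ge1 (3 * A * B)) dbl.
move: (doubling_const _) => Q2 Q21 dbl.
set r := ds a b; have r0 : 0 <= r := profile_ds_ge0 p a b.
have AQ : 0 <= 6 * A * Q2 * r by rewrite !mulr_ge0//; lra.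
have [T2|T2] := leP (len a b) (2 * r); first by lra.
have [M0 _ Mmax] := EVT_max ab (profile_continuous_itv p (lexx a) (lexx b)).
set M := delta M0 in Mmax.
have Mpos : 0 <= M.
  have : 0 < delta a by apply: (profile_gt0 p); rewrite lexx.
  have := Mmax a; rewrite in_itv /= lexx ab => /(_ isT); lra.
have mono s t : a <= s -> s <= t -> t <= b -> len a t = len a s + len s t /\ 0 <= len s t.
  by move=> as_ st tb; rewrite (profile_lenD p (lexx a) as_ st tb) (profile_len_ge0 p).
have lena : len a a = 0.
  have := profile_lenD p (lexx a) (lexx a) (lexx a) ab; lra.
have clen : {within `[a, b], continuous (len a)}.
  have lip s t : a <= s -> s <= t -> t <= b -> `|len a s - len a t| <= 2 * M * (t - s).
    move=> as_ st tb; have [E l0] := mono s t as_ st tb.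
    rewrite distrC ger0_norm; last by lra.
    have : len s t <= 2 * M * (t - s); last by lra.
    apply: (profile_len_le p) => // u /andP[su ut].
    by apply: Mmax; rewrite in_itv /=; lra.
  apply: (@lipschitz_within _ R^o _ _ _ (2 * M)); first by rewrite mulr_ge0.
  move=> s t /andP[as_ sb] /andP[at_ tb]; rewrite /mdist /=.
  have [st|/ltW ts] := leP s t.
    by rewrite [`|s - t|]distrC (ger0_norm (x := t - s)) ?subr_ge0// distrC lip.
  by rewrite (ger0_norm (x := s - t)) ?subr_ge0// lip.
have reach x : 0 <= x <= len a b -> exists2 s, a <= s <= b & len a s = x.
  move=> xI; have [|s] := @IVT _ (len a) a b x ab clen.
    by rewrite lena ge_min le_max; apply/andP; split; apply/orP; [left|right]; lra.
  by rewrite in_itv /= => sI sx; exists s.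
have [s /andP[as_ sb] sr] := reach r ltac:(lra).
have [s' /andP[as' s'b] sr'] := reach (len a b - r) ltac:(lra).
have ss' : s <= s'.
  have [//|/ltW s's] := leP s s'; have [] := mono s' s as' s's sb; lra.
have [Es' l0] := mono s' b as' s'b (lexx _).
have [Es l0'] := mono s b as_ sb (lexx _).
have [Ess l0''] := mono s s' as_ ss' s'b.
have deep u : a <= u <= b -> r <= len a u -> r <= len u b -> r <= B * delta u.
  move=> uI h1 h2; have [c1 c2] := cone u uI.
  by have [/c1|/ltW/c2] := leP u t0; lra.
have ds_ := deep s ltac:(lra) ltac:(lra) ltac:(lra).
have ds'_ := deep s' ltac:(lra) ltac:(lra) ltac:(lra).
pose m := Num.min (delta s) (delta s').
have m0 : 0 < m by rewrite lt_min !(profile_gt0 p)//; lra.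
have rm : r <= B * m.
  by rewrite /m /Num.min; case: ifP.
have ms : m <= delta s by rewrite ge_min lexx.
have ms' : m <= delta s' by rewrite ge_min lexx orbT.
have gap : s' - s <= A * (3 * r / m).
  have := profile_gap p as_ ss' s'b m0 ms ms' (lexx 0).
  rewrite mulr0 add0r addr0 divr1 => /le_trans; apply.
  rewrite ler_wpM2l ?(ltW A0)// ler_wpM2r ?invr_ge0 ?(ltW m0)//.
  by have := profile_ds_triangle p as_ ss' s'b; rewrite -/r; lra.
have gap2 : s' - s <= 3 * A * B.
  apply: (le_trans gap).
  have -> : 3 * A * B = A * (3 * B) by lra.
  rewrite ler_wpM2l ?(ltW A0)// ler_pdivrMr//; lra.
have AB : 0 <= 3 * A * B by rewrite mulr_ge0// mulr_ge0// ltW.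
have dm u : s <= u <= s' -> delta u <= Q2 * m.
  move=> /andP[su us']; rewrite /m /Num.min; case: ifP => _.
    by apply: dbl; [lra..|exact: AB|rewrite distrC ger0_norm; lra].
  by apply: dbl; [lra..|exact: AB|rewrite ger0_norm; lra].
have : len s s' <= 6 * A * Q2 * r; last by lra.
apply: (le_trans (profile_len_le p as_ ss' s'b dm)).
apply: (@le_trans _ _ (2 * (Q2 * m) * (A * (3 * r / m)))).
  by rewrite ler_wpM2l// !mulr_ge0//; lra.
have -> // : 2 * (Q2 * m) * (A * (3 * r / m)) = 6 * A * Q2 * r.
by field; rewrite gt_eqF.
Qed.

End cone_profile.

(** * Uniform spaces *)

Section uniform_spaces.
Context {R : realType} {X : metricType R}.
Implicit Types x y z : X.

Section nice_space.
Context (lcX : locally_compact [set: X]) (incX : ~ metric_complete X).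
Context (rcX : rectifiably_connected X).

Let delta_gt0 x : 0 < boundary_dist x := boundary_dist_gt0 x lcX incX.

(** The source of [profile_gap]. At arc length s the boundary distance is at least (m + min(s, L -
    s)) / (1 + 2 a). End pieces of length m N have density at most (1 + 2 a) / m and cost (1 + 2 a)
    N each. The rest has density at most (1 + 2 a) / (m (1 + N)) and length at most a d(x, y). If
    the end pieces overlap, L < 2 m N and the density bound (1 + 2 a) / m suffices. *)
Lemma qh_dist_double_cone (a : R) (g : @curve R X) x y (m N : R) : 1 <= a ->
  joins g x y -> double_cone_arc a g -> quasiconvex a g ->
  0 < m -> m <= boundary_dist x -> m <= boundary_dist y -> 0 <= N ->
  qh_dist x y <= (1 + 2 * a) * a * (2 * N + (mdist x y / m) / (1 + N)).
Proof.
move=> a1 [gx gy] [_ cone] qc m0 mx my N0.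
have rg : rectifiable g by apply: le_lt_trans qc _; rewrite ltry.
have Lad : total_length g <= a * mdist x y.
  by rewrite -lee_fin total_lengthE// -gx -gy.
have Lge0 := total_length_ge0 g.
have [G pG _] := line_integral_primitive lcX incX rg.
have lip := one_lipschitz_arclength_param rg.
have h0 : arclength_param g 0 = x by rewrite arclength_param0.
have hL : arclength_param g (total_length g) = y by rewrite arclength_paramL.
have kG : qh_dist x y <= G (total_length g) - G 0.
  by apply: (qh_dist_le lcX incX rcX); exists (total_length g), (arclength_param g), G.
have cone_h s : 0 <= s -> s <= total_length g ->
    s <= a * boundary_dist (arclength_param g s) \/
    total_length g - s <= a * boundary_dist (arclength_param g s).
  move=> s0 sL; have /andP[la ah] := arrival_itv rg sL.
  have Vs : travelled g (arrival g s) = s by apply: travelled_arrival; rewrite ?s0.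
  have := cone (arrival g s); rewrite in_itv /= la ah => /(_ isT).
  rewrite !length_travelled ?lo_le_hi// Vs travelled_lo// travelled_hi subr0.
  by rewrite ge_min !lee_fin => /orP.
move: Lad Lge0 pG lip hL kG cone_h; set L := total_length g.
set h := arclength_param g in h0 *; move=> Lad L0 [uG _] lip hL kG cone_h.
have low s : 0 <= s -> s <= L -> (m + s <= (1 + 2 * a) * boundary_dist (h s)) \/
    (m + (L - s) <= (1 + 2 * a) * boundary_dist (h s)).
  move=> s0 sL; have ds := delta_gt0 (h s).
  have := lip 0 s (lexx _) s0 sL; rewrite h0 => d1.
  have := lip s L s0 sL (lexx _); rewrite hL => d2.
  have := boundary_dist_lip x (h s) incX; have := boundary_dist_lip y (h s) incX.
  rewrite (metric_sym y) => d3 d4.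
  by have [H|H] := cone_h s s0 sL; [left|right]; lra.
have k0 : 0 < 1 + 2 * a by lra.
have dens s c : 0 <= s -> s <= L -> 0 < c -> c <= m + s -> c <= m + (L - s) ->
    qh_density h s <= (1 + 2 * a) / c.
  move=> s0 sL c0 c1 c2; have ds := delta_gt0 (h s).
  rewrite /qh_density ler_pdivlMr// mulrC ler_pdivrMr//.
  by have [H|H] := low s s0 sL; lra.
have cost s t c : 0 <= s -> s <= t -> t <= L -> 0 < c ->
    c <= m + s -> c <= m + (L - t) -> G t - G s <= (1 + 2 * a) / c * (t - s).
  move=> s0 st tL c0 c1 c2; apply: uG => // u /andP[su ut].
  by apply: dens => //; lra.
have a0 : 0 <= a by lra.
have d0 : 0 <= mdist x y := mdist_ge0 x y.
have N1 : 0 < 1 + N by lra.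
have q0 : 0 <= mdist x y / m / (1 + N) by rewrite !divr_ge0// ltW.
apply: (le_trans kG).
have [big|small] := leP (m * N) (L / 2); last first.
  have := cost 0 L m (lexx _) L0 (lexx _) m0 ltac:(lra) ltac:(lra).
  rewrite subr0 mulrAC => /le_trans; apply; rewrite ler_pdivrMr//.
  apply: (@le_trans _ _ ((1 + 2 * a) * (2 * (m * N)))).
    by rewrite ler_wpM2l ?(ltW k0)//; lra.
  rewrite -!mulrA ler_wpM2l ?(ltW k0)//.
  have -> : 2 * (m * N) = 2 * N * m by lra.
  rewrite mulrA ler_wpM2r ?(ltW m0)//.
  apply: (@le_trans _ _ (2 * N + mdist x y / m / (1 + N))); first by rewrite lerDl.
  rewrite -[leLHS]mul1r mulrA ler_wpM2r// addr_ge0// mulr_ge0//.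
have mN0 : 0 <= m * N by rewrite mulr_ge0// ltW.
have := cost 0 (m * N) m (lexx _) mN0 ltac:(lra) m0 ltac:(lra) ltac:(lra).
have := cost (m * N) (L - m * N) (m * (1 + N)) mN0 ltac:(lra) ltac:(lra)
  ltac:(rewrite mulr_gt0//) ltac:(lra) ltac:(lra).
have := cost (L - m * N) L m ltac:(lra) ltac:(lra) (lexx _) m0 ltac:(lra) ltac:(lra).
have -> : (1 + 2 * a) / m * (L - (L - m * N)) = (1 + 2 * a) * N.
  by field; rewrite gt_eqF.
have -> : (1 + 2 * a) / m * (m * N - 0) = (1 + 2 * a) * N by field; rewrite gt_eqF.
have mid : (1 + 2 * a) / (m * (1 + N)) * (L - m * N - m * N)
    <= (1 + 2 * a) * (a * (mdist x y / m / (1 + N))).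
  have -> : (1 + 2 * a) * (a * (mdist x y / m / (1 + N)))
      = (1 + 2 * a) / (m * (1 + N)) * (a * mdist x y).
    by field; rewrite !gt_eqF.
  rewrite ler_wpM2l; first by []; last by lra.
  by rewrite divr_ge0 ?(ltW k0)// mulr_ge0// ltW.
have aN : (1 + 2 * a) * (2 * N) <= (1 + 2 * a) * (a * (2 * N)).
  by rewrite ler_wpM2l ?(ltW k0)// ler_peMl// mulr_ge0.
move: mid aN; set E := _ / (m * _) * _; set q := _ / m / _.
clearbody E q; clear; lra.
Qed.

(** * Quasihyperbolic geodesics of a uniform space as cone profiles *)

Section geodesic.
Context (g : @curve R X) (geo : quasihyperbolic_geodesic g).

Local Notation delta := (fun t => boundary_dist (g t)).

Lemma geodesic_qh_dist s t : lo g <= s <= hi g -> lo g <= t <= hi g ->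
  qh_dist (g s) (g t) = `|s - t|.
Proof.
move=> sI tI; have := geo (s := s) (t := t).
by rewrite !in_itv /= sI tI (qh_distE lcX incX rcX) => /(_ isT isT) [].
Qed.

Lemma geodesic_mdist s t : lo g <= s <= hi g -> lo g <= t <= hi g ->
  `|s - t| <= 2^-1 -> mdist (g s) (g t) <= 2 * `|s - t| * delta s.
Proof.
move=> sI tI st; rewrite -(geodesic_qh_dist sI tI).
by apply: (qh_dist_half lcX incX rcX); rewrite geodesic_qh_dist.
Qed.

Lemma geodesic_double s t : lo g <= s <= hi g -> lo g <= t <= hi g ->
  `|s - t| <= 4^-1 -> delta t <= 2 * delta s.
Proof.
move=> sI tI st; have := geodesic_mdist sI tI ltac:(lra).
have := boundary_dist_lip (g t) (g s) incX; rewrite (metric_sym (g t)).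
have ds := delta_gt0 (g s).
have : 2 * `|s - t| * delta s <= 2^-1 * delta s by rewrite ler_wpM2r ?(ltW ds)//; lra.
rewrite /=; lra.
Qed.

(** The local comparison reaches only up to time 1/2, so pieces of that duration are peeled off one
    by one. *)
Lemma geodesic_lipschitz s t M : lo g <= s -> s <= t -> t <= hi g ->
  (forall u, s <= u <= t -> delta u <= M) -> mdist (g s) (g t) <= 2 * M * (t - s).
Proof.
move=> los + thi; have [n] : exists n : nat, 2 * (t - s) <= n%:R.
  have [st|st] := leP 0 (2 * (t - s)).
    by exists (Num.bound (2 * (t - s))); rewrite ltW// archi_boundP.
  by exists 0%N; rewrite ltW.
elim: n t thi => [|n IH] t thi tn st hM.
  have -> : s = t by lra.
  by rewrite mdistxx subrr mulr0.
have [small|big] := leP (t - s) 2^-1.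
  have := geodesic_mdist (s := s) (t := t) ltac:(lra) ltac:(lra).
  rewrite distrC ger0_norm ?subr_ge0// => /(_ small)/le_trans; apply.
  have -> : 2 * M * (t - s) = 2 * (t - s) * M by lra.
  by rewrite ler_wpM2l ?mulr_ge0 ?subr_ge0// hM// lexx.
pose u := t - 2^-1; rewrite -natr1 in tn.
have su : s <= u by rewrite /u; lra.
have ut : u <= t by rewrite /u; lra.
have := IH u ltac:(lra) ltac:(rewrite /u; lra) su _.
move=> /(_ (fun v hv => hM v ltac:(lra))) H1.
have := geodesic_mdist (s := u) (t := t) ltac:(lra) ltac:(lra).
rewrite distrC ger0_norm ?subr_ge0// => /(_ ltac:(rewrite /u; lra)) H2.
have H3 : 2 * (t - u) * delta u <= 2 * (t - u) * M.
  by rewrite ler_wpM2l ?mulr_ge0 ?subr_ge0// hM// su.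
have := metric_triangle (g s) (g u) (g t); move: H1 H2 H3 => /=; lra.
Qed.

Lemma geodesic_delta_continuous : {within `[lo g, hi g], continuous delta}.
Proof.
have /subspace_continuousP cg := path_of_continuous (c := g).
apply/subspace_continuousP => t tI; apply: (@cvg_comp _ _ _ g (@boundary_dist R X)).
  exact: cg.
exact: continuous_boundary_dist.
Qed.

Lemma geodesic_length_le s t M : lo g <= s -> s <= t -> t <= hi g ->
  (forall u, s <= u <= t -> delta u <= M) -> (length g s t <= (2 * M * (t - s))%:E)%E.
Proof.
move=> los st thi hM; apply: length_lipschitz => u v su uv vt.
apply: geodesic_lipschitz; [lra..|] => w /andP[uw wv].
by apply: hM; lra.
Qed.

(** Being geodesic for k does not by definition include finite d-length; it follows from the
    Lipschitz bound with the maximum of the boundary distance along g. *)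
Lemma geodesic_rectifiable : rectifiable g.
Proof.
have [m _ mmax] := EVT_max (lo_le_hi g) geodesic_delta_continuous.
apply: le_lt_trans (@geodesic_length_le (lo g) (hi g) (delta m) _ _ _ _) _ => //;
  rewrite ?lo_le_hi ?ltry//.
Qed.

Lemma geodesic_profile a : 1 <= a ->
  (forall x y, exists h : @curve R X,
    [/\ joins h x y, double_cone_arc a h & quasiconvex a h]) ->
  cone_profile ((1 + 2 * a) * a) (lo g) (hi g) delta
    (fun s t => fine (length g s t)) (fun s t => mdist (g s) (g t)).
Proof.
move=> a1 unif; have rg := geodesic_rectifiable.
have lenE s t : lo g <= s -> s <= t -> t <= hi g ->
    fine (length g s t) = travelled g t - travelled g s.
  by move=> los st thi; rewrite length_travelled.
split.
- exact: lo_le_hi.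
- by move=> t _; exact: delta_gt0.
- move=> t tI e e0; have /(@within_itv_mdistP R R^o)/(_ t tI e e0) := geodesic_delta_continuous.
  by move=> [d d0 dP]; exists d => // s sI ts; rewrite distrC; exact: dP.
- exact: geodesic_double.
- by move=> s t los st thi; rewrite fine_ge0// length_ge0.
- by move=> s t u los st tu uhi; rewrite !lenE//; lra.
- move=> s t M los st thi hM; have := geodesic_length_le los st thi hM.
  by rewrite length_travelled// lenE.
- by move=> s t; exact: mdist_ge0.
- by move=> s t los st thi; rewrite lenE// mdist_travelled.
- move=> s t los st thi; rewrite !lenE//; try lra.
  have := mdist_travelled rg (lexx (lo g)) los ltac:(lra).
  have := mdist_travelled rg (le_trans los st) thi (lexx _).
  have := metric_triangle (g s) (g (lo g)) (g t).
  have := metric_triangle (g (lo g)) (g (hi g)) (g t).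
  by rewrite (metric_sym (g s) (g (lo g))) (metric_sym (g (hi g)) (g t)); lra.
- move=> s t m N los st thi m0 ms mt N0.
  have [h [hst hc hq]] := unif (g s) (g t).
  have := qh_dist_double_cone a1 hst hc hq m0 ms mt N0.
  by rewrite geodesic_qh_dist; [rewrite distrC ger0_norm ?subr_ge0|lra..].
Qed.

End geodesic.

Lemma uniform_gehring_hayman : uniform_space X -> gehring_hayman X.
Proof.
move=> [a [a1 unif]]; pose A := (1 + 2 * a) * a.
have A1 : 1 <= A by rewrite /A mulr_ege1//; lra.
have C1 : 1 <= quasiconvex_const A.
  have Q1 := doubling_const_ge1 (3 * A * cone_const A).
  have A0 : 0 <= 6 * A by lra.
  rewrite /quasiconvex_const; have := mulr_ge0 A0 (le_trans ler01 Q1); lra.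
exists (quasiconvex_const A); split=> // x y g b geo [gx gy] [bx by_].
have rg := geodesic_rectifiable geo.
have := profile_quasiconvex A1 (geodesic_profile geo a1 unif).
rewrite -/(curve_length g) -/(total_length g) -lee_fin total_lengthE// => /le_trans; apply.
rewrite EFinM lee_pmul2l//; last by rewrite lte_fin; lra.
by rewrite gx gy -bx -by_; apply: mdist_le_length; exact: lo_le_hi.
Qed.

Lemma uniform_ball_separation : uniform_space X -> ball_separation X.
Proof.
move=> [a [a1 unif]]; pose A := (1 + 2 * a) * a.
have A1 : 1 <= A by rewrite /A mulr_ege1//; lra.
(* The [+ 1] turns the cone estimate into the strict inequality of an open ball. *)
exists (cone_const A + 1); split; first by have := cone_const_ge0 A; lra.
move=> x y g b geo [gx gy] [bx by_] _ [t tI <-].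
rewrite /= in_itv /= in tI; have /andP[lot thi] := tI.
have rg := geodesic_rectifiable geo.
have p := geodesic_profile geo a1 unif.
have [t0 _ /(_ t tI)[c1 c2]] := profile_cones A1 p.
have dt := delta_gt0 (g t).
have [/c1 H|/ltW/c2 H] := leP t t0.
- exists x; split; last by exists (lo b); rewrite //= in_itv /= lexx lo_le_hi.
  rewrite ballEmdist /=; have := profile_ds_len p (lexx _) lot thi.
  by rewrite gx metric_sym; lra.
- exists y; split; last by exists (hi b); rewrite //= in_itv /= lexx lo_le_hi.
  rewrite ballEmdist /=; have := profile_ds_len p lot thi (lexx _).
  by rewrite gy; lra.
Qed.

End nice_space.

(** * From John and GHS to uniform *)

Lemma curve_sub (g : @curve R X) s t : lo g <= s -> s <= t -> t <= hi g ->
  exists h : @curve R X, [/\ lo h = s, hi h = t & path_of h = path_of g].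
Proof.
move=> los st thi; have cg : {within `[s, t], continuous g}.
  apply: continuous_subspaceW (path_of_continuous (c := g)) => u /=.
  rewrite !in_itv /=; lra.
by exists (Curve st cg).
Qed.

Lemma gehring_hayman_quasiconvex C (g : @curve R X) s t : length_space X -> 1 <= C ->
  (forall (x y : X) (g b : @curve R X), quasihyperbolic_geodesic g ->
    joins g x y -> joins b x y -> (curve_length g <= C%:E * curve_length b)%E) ->
  quasihyperbolic_geodesic g -> lo g <= s -> s <= t -> t <= hi g ->
  (length g s t <= (C * mdist (g s) (g t))%:E)%E.
Proof.
move=> lsX C1 gh geo los st thi; have [h [hs ht hg]] := curve_sub los st thi.
have geoh : quasihyperbolic_geodesic h.
  move=> u v; rewrite hs ht hg !in_itv /= => uI vI; apply: geo; rewrite in_itv /=; lra.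
have hst : joins h (g s) (g t) by rewrite /joins hs ht hg.
have C0 : 0 < C by lra.
rewrite EFinM -lee_pdivrMl// lsX; apply: le_ereal_inf_tmp => _ [b [_ bst] <-].
rewrite lee_pdivrMl//; have := gh _ _ _ _ geoh hst bst.
by rewrite /curve_length hs ht hg.
Qed.

Lemma john_ghs_uniform : john_space X -> ghs_space X -> uniform_space X.
Proof.
move=> [a [a1 john]] [[lcX incX rcX _] lsX [Cg [Cg1 gh]] [Cb [Cb1 bs]]].
have delta_gt0 x : 0 < boundary_dist x := boundary_dist_gt0 x lcX incX.
(* With D the boundary distance of z: that of w is at most (1 + Cb) D, so an endpoint is within a (1
   + Cb) D of w, and w is within Cb D of z. The factor [Cg] then converts this distance into the
   length of the subarc. *)
pose C1 := a * (1 + Cb) + Cb.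
have C11 : 1 <= C1.
  rewrite /C1; have : 0 <= a * (1 + Cb) by rewrite mulr_ge0//; lra.
  lra.
have Cg0 : 0 <= Cg by lra.
have CgC : Cg <= Cg * C1 by rewrite ler_peMr.
exists (Cg * C1); split=> [|x y]; first by lra.
have [g geo gxy] := exists_quasihyperbolic_geodesic lcX incX rcX lsX x y.
have [gx gy] := gxy.
have qc s t := gehring_hayman_quasiconvex lsX Cg1 gh geo (s := s) (t := t).
exists g; split=> //; last first.
  apply: le_trans (qc _ _ (lexx _) (lo_le_hi g) (lexx _)) _.
  by rewrite lee_fin ler_wpM2r// mdist_ge0.
split.
  move=> s t sI tI gst; have := geo s t sI tI.
  rewrite (qh_distE lcX incX rcX) gst (qh_distxx lcX incX rcX) => -[] /esym/eqP.
  by rewrite normr_eq0 subr_eq0 => /eqP.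
move=> t tI; have [b [[bx by_] [_ cone]]] := john x y.
have gt : trace g (g t) by exists t.
have [w [zw [u uI uw]]] := bs x y g b geo gxy (conj bx by_) (g t) gt.
rewrite /= in uI; rewrite ballEmdist /= in zw.
rewrite in_itv /= in tI; have /andP[lot thi] := tI.
have dt := delta_gt0 (g t).
have near : boundary_dist w <= (1 + Cb) * boundary_dist (g t).
  have := boundary_dist_lip w (g t) incX; rewrite metric_sym; lra.
have near_a : a * boundary_dist w <= a * ((1 + Cb) * boundary_dist (g t)).
  by rewrite ler_wpM2l//; lra.
have final (d : R) (l : \bar R) : (l <= (Cg * d)%:E)%E -> d <= C1 * boundary_dist (g t) ->
    (l <= (Cg * C1 * boundary_dist (g t))%:E)%E.
  move=> /le_trans + dC; apply.
  by rewrite lee_fin -mulrA ler_wpM2l.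
have := cone u uI; rewrite in_itv /= in uI; have /andP[lou uhi] := uI.
rewrite uw ge_min => /orP[] /(le_trans (mdist_le_length b _)).
- move=> /(_ lou); rewrite lee_fin bx uw => xw.
  rewrite ge_min; apply/orP; left; apply: final (qc _ _ (lexx _) lot thi) _.
  rewrite gx; have := metric_triangle x w (g t); rewrite (metric_sym w) /C1; lra.
- move=> /(_ uhi); rewrite lee_fin by_ uw => wy.
  rewrite ge_min; apply/orP; right; apply: final (qc _ _ lot thi (lexx _)) _.
  rewrite gy; have := metric_triangle (g t) w y; rewrite /C1; lra.
Qed.

End uniform_spaces.

Theorem corollary1p5 (R : realType) (X : metricType R) :
  minimally_nice X -> length_space X ->
  (uniform_space X <-> john_space X /\ ghs_space X).
Proof.
move=> nX lsX; have [lcX incX rcX _] := nX; split=> [uX|[jX ghsX]]; last exact: john_ghs_uniform.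
split.
  have [a [a1 unif]] := uX; exists a; split=> // x y.
  by have [g [gxy ga _]] := unif x y; exists g.
split=> //; first exact: uniform_gehring_hayman.
exact: uniform_ball_separation.
Qed.
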